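(* Let $e\ge 2$ be an integer and, for $n\ge 0$, let $mf_e(n)$ be the number of $e$-regular partitions $\lambda\vdash n$ with $m_e(\lambda)=\lambda$, where $m_e$ is the Mullineux map. Let $MF_e(q)=\sum_{n\ge0} mf_e(n)q^n$. (a) If $e$ is odd, then $mf_e(n)$ equals the number of partitions of $n$ into distinct odd parts none of which is divisible by $e$; equivalently $$MF_e(q)=\frac{\chi(q)}{\chi(q^e)}=\frac{(1+q)(1+q^3)(1+q^5)\cdots}{(1+q^e)(1+q^{3e})(1+q^{5e})\cdots}=\prod_{\substack{k\ \text{odd}\\ e\nmid k}}(1+q^k).$$ (b) If $e$ is even, then $mf_e(n)$ equals the number of partitions of $n$ all of whose parts are either odd or odd multiples of $e$, and whose odd parts are all distinct; equivalently $$MF_e(q)=\frac{\chi(q)}{\chi(-q^e)}=\frac{(1+q)(1+q^3)(1+q^5)\cdots}{(1-q^e)(1-q^{3e})(1-q^{5e})\cdots}.$$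
   Context: A partition is $e$-regular if no part is repeated $e$ or more times. The rim of a partition $\lambda$ consists of the boxes $(i,j)$ of its Young diagram with $(i+1,j+1)$ not in the diagram. The $e$-rim is the following subset of the rim: starting at the top right box of the rim, take the first $e$ boxes of the rim (moving along the rim towards the bottom left); then move to the rightmost rim box in the next row below the last box taken and take the next $e$ rim boxes; continue until the last row is reached (the final segment may have fewer than $e$ boxes). Let $a_1$ be the number of boxes and $r_1$ the number of rows of the $e$-rim; remove the $e$-rim and repeat on what remains to get $(a_2,r_2)$, and so on until no boxes remain, giving $(a_1,r_1),\dots,(a_k,r_k)$. The array with top row $a_1,\dots,a_k$ and bottom row $r_1,\dots,r_k$ is the Mullineux symbol $G_e(\lambda)$; an $e$-regular partition is determined by its Mullineux symbol. Put $\epsilon_i=0$ if $e\mid a_i$ and $\epsilon_i=1$ otherwise, and $s_i=a_i-r_i+\epsilon_i$. The Mullineux map $m_e$ is the involution on $e$-regular partitions of $n$ sending $\lambda$ to the $e$-regular partition whose Mullineux symbol has top row $a_1,\dots,a_k$ and bottom row $s_1,\dots,s_k$. Notation: $(a;q)_\infty=\prod_{k\ge0}(1-aq^k)$ and $\chi(q)=(-q;q^2)_\infty=(1+q)(1+q^3)(1+q^5)\cdots$. *)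

(* Defs.v *)
From HB Require Import structures.
From mathcomp Require Import all_boot all_order all_algebra.

Set Implicit Arguments.
Unset Strict Implicit.
Unset Printing Implicit Defensive.

Import GRing.Theory.

Definition is_partition (l : seq nat) : bool := sorted geq l && (0 \notin l).

Record intpart (n : nat) := IntPart {
  parts :> seq nat;
  _ : is_partition parts && (sumn parts == n)
}.

HB.instance Definition _ n := [isSub for @parts n].
HB.instance Definition _ n := [Countable of intpart n by <:].

Lemma intpartP n (l : intpart n) : is_partition l /\ sumn l = n.
Proof. by case: l => l /= /andP[lP /eqP]. Qed.

Lemma leq_mem_sumn (l : seq nat) x : x \in l -> x <= sumn l.
Proof.
elim: l => //= y l IHl; rewrite inE => /orP[/eqP->|/IHl le_x].
  exact: leq_addr.
exact: leq_trans le_x (leq_addl _ _).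
Qed.

Lemma size_leq_sumn (l : seq nat) : 0 \notin l -> size l <= sumn l.
Proof.
elim: l => //= y l IHl; rewrite inE negb_or eq_sym -lt0n => /andP[y_gt0 /IHl].
by rewrite -add1n; apply: leq_add.
Qed.

(* A partition of n has at most n parts, each at most n; this makes
   intpart n a finite type. *)
Definition intpart_bseq n (l : intpart n) : n.-bseq 'I_n.+1 :=
  insub_bseq n (map inord l).

Definition bseq_intpart n (b : n.-bseq 'I_n.+1) : option (intpart n) :=
  insub (map val b).

Lemma intpart_bseqK n : pcancel (@intpart_bseq n) (@bseq_intpart n).
Proof.
move=> l; have [/andP[_ l_pos] sum_l] := intpartP l.
have sz_l : size (map (@inord n) l) <= n.
  by rewrite size_map -[leqRHS]sum_l size_leq_sumn.
rewrite /bseq_intpart /intpart_bseq [map val _](_ : _ = map val (map (@inord n) l)).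
  2: by congr map; apply: (insubdK (sT := n.-bseq 'I_n.+1)).
rewrite -map_comp map_id_in ?valK // => x xl /=.
by rewrite inordK // ltnS -[leqRHS]sum_l leq_mem_sumn.
Qed.

HB.instance Definition _ n : isFinite (intpart n) :=
  PCanIsFinite (@intpart_bseqK n).

Definition e_regular (e : nat) (l : seq nat) : bool :=
  all (fun x => count_mem x l < e) l.

(* The box (i, j) is in row i and column j; both are numbered from 0. *)
Definition in_diagram (l : seq nat) (b : nat * nat) : bool :=
  b.2 < nth 0 l b.1.

(* Rows from top to bottom, each row from right to left: restricted to the
   rim, this is the order of the walk from its top right box to its bottom
   left box. *)
Definition boxes (l : seq nat) : seq (nat * nat) :=
  [seq (i, j) | i <- iota 0 (size l), j <- rev (iota 0 (nth 0 l i))].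

Definition rim (l : seq nat) : seq (nat * nat) :=
  [seq b <- boxes l | ~~ in_diagram l (b.1.+1, b.2.+1)].

(* For 0 < e, each step consumes at least one box of r, so a fuel of size r
   suffices. *)
Fixpoint erim_walk (fuel e : nat) (r : seq (nat * nat)) : seq (nat * nat) :=
  if fuel is fuel'.+1 then
    if r is b :: _ then
      let seg := take e r in
      seg ++ erim_walk fuel' e [seq c <- r | (last b seg).1 < c.1]
    else [::]
  else [::].

Definition erim (e : nat) (l : seq nat) : seq (nat * nat) :=
  erim_walk (size (rim l)) e (rim l).

Definition erim_rows (e : nat) (l : seq nat) : nat :=
  size (undup [seq b.1 | b <- erim e l]).

(* The boxes of the e-rim lying in a given row are its rightmost ones. *)
Definition remove_erim (e : nat) (l : seq nat) : seq nat :=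
  [seq x <- [seq nth 0 l i - count (fun b => b.1 == i) (erim e l)
            | i <- iota 0 (size l)] | x != 0].

Fixpoint mullineux_symbol_rec (fuel e : nat) (l : seq nat) : seq (nat * nat) :=
  if fuel is fuel'.+1 then
    if l is [::] then [::]
    else (size (erim e l), erim_rows e l)
           :: mullineux_symbol_rec fuel' e (remove_erim e l)
  else [::].

(* The columns (a_i, r_i). For 0 < e, each removal decreases the sum of the
   parts, so a fuel of sumn l suffices. *)
Definition mullineux_symbol (e : nat) (l : seq nat) : seq (nat * nat) :=
  mullineux_symbol_rec (sumn l) e l.

(* The truncated subtraction is harmless, since r_i <= a_i. *)
Definition mullineux_column (e : nat) (c : nat * nat) : nat * nat :=
  (c.1, c.1 - c.2 + ~~ (e %| c.1)).

(* The e-regular partition of n whose symbol is the transformed symbol of l.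
   The option type avoids building its existence (Mullineux's theorem) into
   the definition; None is not a fixed point. *)
Definition mullineux (e n : nat) (l : intpart n) : option (intpart n) :=
  [pick m : intpart n | e_regular e m
    & mullineux_symbol e m == map (mullineux_column e) (mullineux_symbol e l)].

Definition mf (e n : nat) : nat :=
  #|[set l : intpart n | e_regular e l & mullineux e l == Some l]|.

Local Open Scope ring_scope.

(* A formal power series over the integers, given by its coefficients; equality
   of series is pointwise equality. *)
Definition fps := nat -> int.

Definition fps_mul (f g : fps) : fps :=
  fun n => \sum_(i < n.+1) f i * g (n - i)%N.

(* The first n coefficients of f / g. *)
Fixpoint fps_div_seq (f g : fps) (n : nat) : seq int :=
  if n is m.+1 then
    let s := fps_div_seq f g m in
    rcons s ((g 0%N)^-1 * (f m - \sum_(i < m) s`_i * g (m - i)%N))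
  else [::].

Definition fps_div (f g : fps) : fps := fun n => (fps_div_seq f g n.+1)`_n.

Lemma size_fps_div_seq f g n : size (fps_div_seq f g n) = n.
Proof. by elim: n => //= n IHn; rewrite size_rcons IHn. Qed.

Lemma nth_fps_div_seq f g n i :
  (i < n)%N -> (fps_div_seq f g n)`_i = fps_div f g i.
Proof.
elim: n => // n IHn; rewrite ltnS leq_eqVlt => /orP[/eqP-> // | lt_in].
by rewrite /= nth_rcons size_fps_div_seq lt_in IHn.
Qed.

Lemma fps_divE f g n : fps_div f g n =
  (g 0%N)^-1 * (f n - \sum_(i < n) fps_div f g i * g (n - i)%N).
Proof.
rewrite {1}/fps_div /= nth_rcons size_fps_div_seq ltnn eqxx.
by congr (_ * (_ - _)); apply: eq_bigr => i _; rewrite nth_fps_div_seq.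
Qed.

Lemma fps_divK f g : g 0%N \is a GRing.unit -> fps_mul (fps_div f g) g =1 f.
Proof.
move=> g0 n; rewrite /fps_mul big_ord_recr /= subnn [fps_div f g n]fps_divE.
by rewrite mulrAC mulVr // mul1r addrC subrK.
Qed.

Lemma fps_div_unique f g h : g 0%N \is a GRing.unit ->
  fps_mul h g =1 f -> h =1 fps_div f g.
Proof.
move=> g0 hg n; elim/ltn_ind: n => n IHn; rewrite fps_divE -hg /fps_mul.
rewrite big_ord_recr /= subnn; set S := \sum_(i < n) _.
rewrite (_ : \sum_(i < n) _ = S); last by apply: eq_bigr => i _; rewrite IHn.
by rewrite addrC addrK mulrC mulrK.
Qed.

(* The infinite product of the F k, for F k congruent to 1 modulo 'X^k: the
   coefficient of 'X^n then only depends on the factors with k <= n, see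
   infprod_stable. *)
Definition infprod (F : nat -> {poly int}) : fps :=
  fun n => (\prod_(k < n.+1) F k)`_n.

Lemma infprod_stable (F : nat -> {poly int}) :
  (forall k, exists G, F k = 1 + G * 'X^k) ->
  forall N n, (n < N)%N -> (\prod_(k < N) F k)`_n = infprod F n.
Proof.
move=> F1 N n; elim: N => // N IHN; rewrite ltnS leq_eqVlt.
case/orP=> [/eqP-> // | lt_nN]; rewrite big_ord_recr /=.
have [G ->] := F1 N; rewrite mulrDr mulr1 coefD IHN // mulrA coefMXn lt_nN.
by rewrite addr0.
Qed.

(* (a; x)_oo, for x without constant term. *)
Definition qpoch (a x : {poly int}) : fps := infprod (fun k => 1 - a * x ^+ k).

(* chi x = (- x; x ^ 2)_oo, where x is the argument substituted for q. *)
Definition chi (x : {poly int}) : fps := qpoch (- x) (x ^+ 2).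

Definition MF (e : nat) : fps := fun n => (mf e n)%:Z.

(* Main.v *)
(** The e-rim meets every row, so a column (a, r) of the Mullineux symbol of l
    records the size and the number of rows of l before the e-rim is removed.
    Removing the e-rim can be undone from the bottom row upwards once a and r
    are known, and the possible pairs (a, r) are exactly those with
    r' + eps <= r < r' + eps + e and
    a' - r' + eps' <= a - r < a' - r' + eps' + e, where (a', r') is the next
    column and eps, eps' are 0 or 1 according to divisibility by e. A fixed
    point has 2 r_i = a_i + eps_i, so it is given by its top row, a partition
    with parts odd exactly when e does not divide them and with consecutive
    differences confined to a window of length 2e.

    Modulo N = 2e such a window contains one representative of each residue, so
    the top row is a word in the residues, letter 0 included, and its size is a
    major index. Absorbing the letters 0 into the other letters turns the word
    into a partition without parts divisible by 2e in which only multiples of e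
    are repeated (a MacMahon-type bijection, as in Bessenrodt's proof of the
    Andrews-Olsson identity). *)
Require Import Defs.
From mathcomp Require Import all_boot all_order all_algebra.
From mathcomp Require Import zify.

Set Implicit Arguments.
Unset Strict Implicit.
Unset Printing Implicit Defensive.

Import GRing.Theory.

(** * Removing the e-rim row by row *)

Definition antitone (x : nat -> nat) := forall i, x i.+1 <= x i.

(* Partitions are handled through their row lengths x i. The segment of the
   e-rim running through row i would cut that row down to length
   reach e x i - e (as an integer) if it did not leave it for the next row;
   this bound grows by one from a row to the next inside a segment. *)
Fixpoint reach e (x : nat -> nat) i :=
  if i is j.+1 then
    if (x i).-1 + e <= reach e x j then x i else (reach e x j).+1
  else x 0.

(* Row i after the removal of the e-rim. *)
Definition strip e x i := maxn (reach e x i - e) (x i.+1).-1.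

(** For non-increasing rows this excludes [e] consecutive equal nonzero rows, [i] and [i + e.-1]
    being the ends of such a run. *)
Definition regular e (x : nat -> nat) :=
  forall i, 0 < x (i + e.-1) -> x (i + e.-1) < x i.

Definition rows (x : nat -> nat) r := forall i, (0 < x i) = (i < r).

Lemma antitone_le x i j : antitone x -> i <= j -> x j <= x i.
Proof.
move=> xA /subnK <-; elim: (j - i) => // k IHk.
by rewrite addSn; apply: leq_trans (xA _) IHk.
Qed.

Section Strip.
Variables (e : nat) (x : nat -> nat).
Hypotheses (e_gt1 : 1 < e) (xA : antitone x).

Lemma reach_bounds i : x i <= reach e x i <= (x i).-1 + e.
Proof.
elim: i => [|i /andP[IH1 IH2]] /=; first by lia.
by have := xA i; case: ifP; lia.
Qed.

Lemma leq_strip i : strip e x i <= (x i).-1.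
Proof. by have := reach_bounds i; have := xA i; rewrite /strip; lia. Qed.

Lemma strip_antitone : antitone (strip e x).
Proof. by move=> i; apply: leq_trans (leq_strip _) (leq_maxr _ _). Qed.

(** Here [q] counts the segments completed above row [i], and [reach e x i - x i] is what the
    current segment has already taken. *)
Lemma strip_prefix i r : rows x r -> i < r ->
  exists q, \sum_(k < i) (x k - strip e x k) = q * e + (reach e x i - x i).
Proof.
move=> xr; elim: i => [|i IHi] lt_ir; first by exists 0; rewrite big_ord0 /= subnn.
have [q qE] := IHi (ltnW lt_ir); rewrite big_ord_recr /= qE.
have := reach_bounds i; have := xA i; have := xr i.+1; rewrite lt_ir.
rewrite /strip; set u := reach e x i => x1 x2 x3.
case: ifP => le_u; [exists q.+1 | exists q]; lia.
Qed.

(** Only the last segment can be cut short by the end of the diagram; its length is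
    [minn e (reach e x r)]. *)
Lemma strip_total r : rows x r.+1 ->
  exists q, \sum_(k < r.+1) (x k - strip e x k) = q * e + minn e (reach e x r).
Proof.
move=> xr; have [q qE] := strip_prefix xr (ltnSn r).
exists q; rewrite big_ord_recr /= qE.
have := reach_bounds r; have := xr r.+1; rewrite ltnn.
by rewrite /strip; lia.
Qed.

Lemma dvdn_strip_total r : rows x r.+1 ->
  (e %| \sum_(k < r.+1) (x k - strip e x k)) = (e <= reach e x r).
Proof.
move=> xr; have [q ->] := strip_total xr.
have := reach_bounds r; have := xr r; rewrite ltnSn => x0 /andP[u0 _].
rewrite dvdn_addr ?dvdn_mull //; case: leqP => [|lt_ue]; rewrite ?dvdnn //.
by rewrite gtnNdvd //; lia.
Qed.

(** Equality of these [e] stripped rows, of length [c], forces length [c.+1] on the rows of [x]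
    after row [i]; regularity then makes row [i] longer and the row after the run at most [c]. Along
    the run [reach] either grows by [e.-1], which overshoots, or restarts and stays below [c + e],
    which leaves only [c = 0]. *)
Lemma strip_run r i : rows x r.+1 -> regular e x -> i + e.-1 < r.+1 ->
  strip e x i = strip e x (i + e.-1) ->
  [/\ strip e x i = 0, i + e.-1 = r & reach e x r < e].
Proof.
move=> xr xreg lt_ir; set c := strip e x i => mE.
have mc k : k <= e.-1 -> strip e x (i + k) = c.
  move=> le_k; apply/eqP; rewrite eqn_leq {2}mE.
  by rewrite !(antitone_le strip_antitone) ?leq_add2l ?leq_addr.
have xc k : 0 < k <= e.-1 -> x (i + k) = c.+1.
  case: k => // k /= lt_k; have := leq_strip (i + k.+1); have := xr (i + k.+1).
  have : strip e x (i + k) = c by apply: mc; lia.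
  by have := mc _ lt_k; rewrite addnS /strip; lia.
have xi : c.+1 < x i by have := xreg i; rewrite xc //; lia.
have xie : x (i + e.-1).+1 <= c.
  have x1 : x i.+1 = c.+1 by rewrite -addn1; apply: xc; lia.
  by have := xreg i.+1; rewrite addSn x1; lia.
have ui : reach e x i <= c + e by move: (erefl c); rewrite {1}/c /strip; lia.
have uc k : k < e.-1 -> reach e x (i + k.+1) = reach e x i + k.+1 \/
    reach e x (i + k.+1) <= c + k.+1.
  elim: k => [|k IHk] lt_k; rewrite addnS /=; (rewrite -addnS xc; last lia).
    by rewrite addn0; case: ifP; lia.
  by case: IHk => [|uE|uE]; [lia | case: ifP; lia..].
have := uc e.-2; rewrite (_ : e.-2.+1 = e.-1); last lia.
have := mE; have := xr (i + e.-1).+1; have := reach_bounds i.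
rewrite /strip; set u := reach e x (i + e.-1) => ub xr1 mE1 /(_ ltac:(lia)) ue.
have [c0 lt_ue] : c = 0 /\ u < e by lia.
have ir : i + e.-1 = r by lia.
by rewrite -ir; split.
Qed.

End Strip.

(** * Comparison of the e-rims of two successive partitions *)

Section Interlace.
Variables (e : nat) (x : nat -> nat) (r r' : nat).
Hypotheses (e_gt1 : 1 < e) (xA : antitone x) (xr : rows x r).
Let m := strip e x.
Let n := strip e m.
Hypothesis mr : rows m r'.

(* The first row of the j-th segment of the e-rim of x is interlaced with that
   of m, so that at any row the two processes are in segments of the same rank
   or m is exactly one segment behind. *)
Lemma reach_interlace i : i < r' ->
  let u := reach e x i in let u' := reach e m i in
  let a := \sum_(k < i) (x k - m k) in let a' := \sum_(k < i) (m k - n k) in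
  u' < u <= u' + e /\ a + x i + u' = a' + m i + u \/
  u <= u' /\ a + x i + u' = a' + m i + u + e.
Proof.
elim: i => [|i IHi] lt_ir.
  left; rewrite !big_ord0 /=; have := mr 0; have := reach_bounds e_gt1 xA 0.
  have := leq_strip e_gt1 xA 0; rewrite -/m.
  have : x 0 - e <= m 0 by apply: leq_maxl.
  by rewrite /=; lia.
have mA : antitone m by apply: strip_antitone.
move: (IHi (ltnW lt_ir)) => /=; rewrite !big_ord_recr /=.
set A := \sum_(k < i) _; set A' := \sum_(k < i) _.
have m1_gt0 : 0 < m i.+1 by rewrite mr.
have lt_mx : m i < x i by have := leq_strip e_gt1 xA i; have := mA i; rewrite -/m; lia.
have lt_mx1 : m i.+1 < x i.+1 by have := leq_strip e_gt1 xA i.+1; rewrite -/m; lia.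
have lt_nm : n i < m i by have := leq_strip e_gt1 mA i; have := mA i; rewrite -/n; lia.
have /andP[le_xu _] := reach_bounds e_gt1 xA i.
have /andP[le_mu ub'] := reach_bounds e_gt1 mA i.
have : reach e x i.+1 - e <= m i.+1 by apply: leq_maxl.
have le_yx := xA i.
have : n i = maxn (reach e m i - e) (m i.+1).-1 by [].
have : m i = maxn (reach e x i - e) (x i.+1).-1 by [].
rewrite /=; move: (reach e x i) (reach e m i) (m i) (m i.+1) (n i) (x i) (x i.+1) =>
  u u' mi [//|m1] ni xi [//|y] /= in m1_gt0 lt_mx lt_mx1 lt_nm le_xu le_mu ub' le_yx *.
(* Four cases, by whether the segments of [x] and of [m] through row [i] are completed there. *)
case: ifP => uE; case: ifP => u'E mE nE ub.
- have {}mE : u = mi + e by lia.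
  have {}nE : u' = ni + e by lia.
  by case=> [] [ltu AE]; [left; lia | lia].
- have {}mE : u = mi + e by lia.
  have {}nE : ni = m1 by lia.
  by case=> [] [ltu AE]; [right; lia | lia].
- have {}mE : mi = y by lia.
  have {}nE : u' = ni + e by lia.
  by case=> [] [ltu AE]; [lia | left; lia].
have {}mE : mi = y by lia.
have {}nE : ni = m1 by lia.
by case=> [] [ltu AE]; [left; lia | right; lia].
Qed.

(** A row stripped to nothing has at most one box below it, so all rows of [x] after row [j] are
    single boxes. *)
Lemma sum_strip_tail j : j <= r -> (forall k, j <= k -> m k = 0) ->
  \sum_(k < r) (x k - m k) = \sum_(k < j) (x k - m k) + (x j + (r - j).-1).
Proof.
move=> le_jr m0; rewrite -!(big_mkord xpredT (fun k => x k - m k)).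
rewrite (big_cat_nat (leq0n j) le_jr) /=; congr (_ + _).
have x1 k : j < k < r -> x k = 1.
  case: k => // k lt_jk; have := xr k.+1; have : m k = 0 by apply: m0; lia.
  by rewrite /m /strip; lia.
have [lt_jr|ge_jr] := ltnP j r; last first.
  have <- : j = r by lia.
  by rewrite big_geq // subnn; have := xr j; lia.
rewrite big_ltn // m0 // subn0; congr (_ + _).
rewrite (eq_big_nat _ _ (F2 := fun=> 1)) ?sum_nat_const_nat; first by lia.
by move=> k /andP[jk kr]; rewrite x1 ?jk // m0 // ltnW.
Qed.

(** The comparison is [reach_interlace] at the last nonzero row of [m]; the rows of [x] below it are
    counted by [sum_strip_tail]. *)
Lemma strip_window : 0 < r ->
  let a := \sum_(k < r) (x k - m k) in let a' := \sum_(k < r') (m k - n k) in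
  a' + r + ~~ (e %| a') <= a + r' < a' + r + ~~ (e %| a') + e.
Proof.
move=> r_gt0 /=; have mA : antitone m by apply: strip_antitone.
have le_r'r : r' <= r.
  by have := leq_strip e_gt1 xA r; have := xr r; have := mr r; rewrite -/m; lia.
have m0 k : r' <= k -> m k = 0 by have := mr k; lia.
rewrite (sum_strip_tail le_r'r m0).
case r'E : r' => [|i].
  rewrite !big_ord0 dvdn0; have := xr 0; have : m 0 = 0 by apply: m0; rewrite r'E.
  by rewrite /m /strip /=; lia.
have mi : rows m i.+1 by rewrite -r'E.
rewrite (dvdn_strip_total e_gt1 mA mi : (e %| _) = _).
have lt_ir : i < r' by rewrite r'E.
have m1 : m i.+1 = 0 by apply: m0; rewrite r'E.
have mi_gt0 : 0 < m i by rewrite mr.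
have le_yx := xA i.
have lt_mx : m i < x i by have := leq_strip e_gt1 xA i; rewrite -/m; lia.
have lt_nm : n i < m i by have := leq_strip e_gt1 mA i; rewrite -/n; lia.
have /andP[le_xu _] := reach_bounds e_gt1 xA i.
have /andP[le_mu ub'] := reach_bounds e_gt1 mA i.
have y_gt0 : (0 < x i.+1) = (i.+1 < r) by rewrite xr.
have : reach e x i.+1 - e <= m i.+1 by apply: leq_maxl.
have : m i = maxn (reach e x i - e) (x i.+1).-1 by [].
have : n i = reach e m i - e by rewrite /n /strip m1 maxn0.
have := reach_interlace lt_ir; rewrite !big_ord_recr /= -/n.
move: (\sum_(k < i) _) (\sum_(k < i) _) => A' A.
move: (reach e x i) (reach e m i) (m i) (n i) (x i) (x i.+1) =>
  u u' c d xi y in mi_gt0 lt_mx lt_nm le_xu le_mu ub' le_yx y_gt0 *.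
move=> H dE cE; rewrite m1 => ub.
have -> : A + (xi - c) + (y + (r - i.+1).-1) + i.+1 = A + (xi - c) + y.-1 + r.
  by case: y y_gt0 {le_yx cE ub} => [|y] /esym; [move/negbT; rewrite -leqNgt|]; lia.
have {lt_mx le_r'r r_gt0 y_gt0} xE : xi - c + c = xi by lia.
have {H} : u' < u <= u' + e /\ A + (xi - c) + u' = A' + u \/
    u <= u' /\ A + (xi - c) + u' = A' + u + e by case: H => [] [? ?]; [left|right]; lia.
move: (A + (xi - c)) => B H.
(* Is the segment of [x] completed in row [i], the last row of [m]? Comparing [e] with [u'] then
   tells whether the last segment of [m] is full. *)
have [lt_uy|le_yu] := ltnP u (y.-1 + e).
  have {cE} cE : c = y.-1 by lia.
  have {ub} ub : u < e by move: ub; case: ifP; lia.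
  by case: H => [] [uu BE]; case: (leqP e u') => eu /=; lia.
have {cE} cE : u = c + e by lia.
have {ub} ub : y <= e by move: ub; case: ifP; lia.
by case: H => [] [uu BE]; case: (leqP e u') => eu /=; lia.
Qed.

End Interlace.

(** One step of the removal, undone from below: [reach e x i.+1 <= (strip e x i).+1] says that a new
    segment starts in row [i.+1]. *)
Lemma strip_back e x i : 1 < e -> antitone x -> 0 < x i.+1 ->
  x i.+1 = minn (reach e x i.+1) (strip e x i).+1 /\
  reach e x i = if reach e x i.+1 <= (strip e x i).+1 then strip e x i + e
                else (reach e x i.+1).-1.
Proof.
move=> e_gt1 xA y_gt0; have := reach_bounds e_gt1 xA i.
have := xA i; have := reach_bounds e_gt1 xA i.+1; rewrite /strip /=.
move: (reach e x i) (x i) (x i.+1) y_gt0 => u a [//|y] _ /=.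
by case: (leqP (y + e) u) => yu b1 b2 b3; split; try case: ifP; lia.
Qed.

Lemma strip_inj e x y r : 1 < e -> antitone x -> antitone y ->
    rows x r.+1 -> rows y r.+1 ->
    (forall i, i <= r -> strip e x i = strip e y i) ->
    minn e (reach e x r) = minn e (reach e y r) ->
  x =1 y.
Proof.
move=> e_gt1 xA yA xr yr mE uE.
have E k : k <= r -> reach e x (r - k) = reach e y (r - k) /\
    (0 < k -> x (r - k).+1 = y (r - k).+1).
  elim: k => [|k IHk] le_kr.
    have := mE r (leqnn r); have := xr r.+1; have := yr r.+1.
    by rewrite /strip subn0 ltnn; split; lia.
  have [IHu _] := IHk (ltnW le_kr).
  have rk : (r - k.+1).+1 = r - k by lia.
  have [] := strip_back e_gt1 xA (_ : 0 < x (r - k.+1).+1); first by rewrite xr; lia.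
  have [] := strip_back e_gt1 yA (_ : 0 < y (r - k.+1).+1); first by rewrite yr; lia.
  by rewrite mE ?rk ?IHu; [move=> -> -> -> -> | lia].
move=> i; have [lt_ri|le_ir] := ltnP r i.
  by have := xr i; have := yr i; lia.
case: i le_ir => [|i] lt_ir; first by have [] := E r (leqnn r); rewrite subnn.
have [|_] := E (r - i); first lia.
by rewrite subKn ?(ltnW lt_ir) // => -> //; lia.
Qed.

(** * Rebuilding a partition from its remainder and the length of the last segment *)

Section Unstrip.
Variables (e : nat) (m : nat -> nat) (r f : nat).
Hypotheses (e_gt1 : 1 < e) (mA : antitone m) (f_gt0 : 0 < f) (le_fe : f <= e).
Hypotheses (m0 : forall i, r < i -> m i = 0) (mr : f < e -> m r = 0).
Hypothesis mreg : forall i, i + e.-1 <= r -> m i = m (i + e.-1) ->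
  [/\ m i = 0, i + e.-1 = r & f < e].

Lemma unstrip_reach s c : exists u, u s = c /\ forall i, i < s ->
  u i = if u i.+1 <= (m i).+1 then m i + e else (u i.+1).-1.
Proof.
elim: s c => [|s IHs] c; first by exists (fun=> c).
have [u [us uE]] := IHs (if c <= (m s).+1 then m s + e else c.-1).
exists (fun i => if i == s.+1 then c else u i); rewrite eqxx; split=> // i.
rewrite ltnS => le_is; have /negPf-> : i != s.+1 by lia.
by rewrite eqSS; case: eqP => [->|ne_is]; [|rewrite uE //; lia].
Qed.

(** The rows are rebuilt upwards by the recursion of [strip_back], started in row [r] from the
    length [f] of the last segment; [mreg] allows just the runs of equal rows that [strip_run]
    permits. *)
Lemma strip_surj : exists x, [/\ antitone x, rows x r.+1, regular e x,
  strip e x =1 m & minn e (reach e x r) = f].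
Proof.
(* A full last segment cuts row [r] down to [m r]; a shorter one empties it, and its reach is its
   length. *)
have [u [ur uE]] := unstrip_reach r (if f == e then m r + e else f).
have lb i : i <= r -> m i < u i.
  move=> le_ir; rewrite leq_eqVlt in le_ir; case/orP: le_ir => [/eqP->|lt_ir].
    by rewrite ur; case: eqP => [|ne]; [|have := mr]; lia.
  by rewrite uE //; case: ifP; lia.
have ub k : k <= r -> u (r - k) <= m (r - k) + e.
  elim: k => [|k IHk] le_kr; first by rewrite subn0 ur; case: eqP; lia.
  rewrite uE; last lia.
  have := IHk (ltnW le_kr); have -> : r - k = (r - k.+1).+1 by lia.
  by have := mA (r - k.+1); case: ifP; lia.
have {}ub i : i <= r -> u i <= m i + e by move=> le_ir; rewrite -(subKn le_ir) ub ?leq_subr.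
(* The formula of [strip_back], except that row 0 always starts a segment. *)
pose x i := if r < i then 0 else if i is j.+1 then minn (u i) (m j).+1 else u 0.
have xm i : i <= r -> m i < x i.
  rewrite /x leqNgt; case: ltnP => // le_ir _; have := lb i le_ir.
  by case: i le_ir => // i le_ir; have := mA i; lia.
have xS i : x i.+1 <= (m i).+1 by rewrite /x; case: ifP; lia.
have xA : antitone x.
  move=> i; have [lt_ir|le_ri] := ltnP i r.
    by apply: leq_trans (xS i) (xm i (ltnW lt_ir)).
  by rewrite /x [r < i.+1]ltnS le_ri.
have xr : rows x r.+1.
  move=> i; rewrite ltnS; have [lt_ri|le_ir] := ltnP r i; first by rewrite /x lt_ri.
  by rewrite (leq_ltn_trans _ (xm i le_ir)).
have xE i : i < r -> x i.+1 = minn (u i.+1) (m i).+1 by rewrite /x leqNgt => /negPf->.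
have reachE i : i <= r -> reach e x i = u i.
  elim: i => [|i IHi] // lt_ir; rewrite /= IHi ?(ltnW lt_ir) //.
  have := lb _ lt_ir; have := ub _ lt_ir; have := mA i; have := uE _ lt_ir.
  rewrite xE //; set v := u i.+1; set w := u i.
  by case: ifP => vm wE b1 b2 b3; case: ifP; lia.
have stripE : strip e x =1 m.
  move=> i; have [lt_ri|] := ltnP r i.
    by rewrite (m0 lt_ri); have := leq_strip e_gt1 xA i; have := xr i; lia.
  rewrite leq_eqVlt => /orP[/eqP->|lt_ir].
    have := xr r.+1; rewrite /strip reachE // ur.
    by case: eqP => fE; [|have := mr]; lia.
  rewrite /strip reachE ?(ltnW lt_ir) //.
  have := lb _ lt_ir; have := ub _ lt_ir; have := mA i; have := uE _ lt_ir.
  rewrite xE //; set v := u i.+1; set w := u i.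
  by case: ifP => vm wE b1 b2 b3; lia.
exists x; split=> //; last first.
  by rewrite reachE // ur; case: eqP; lia.
move=> i; move xie: (x (i + e.-1)) => c c_gt0.
have := antitone_le xA (leq_addr e.-1 i); rewrite xie leq_eqVlt => /orP[/eqP cE|//].
exfalso; have ie : i + e.-1 <= r by rewrite -ltnS -xr xie.
have xc k : k <= e.-1 -> x (i + k) = c.
  move=> le_k; apply/eqP; rewrite eqn_leq {1}cE -xie.
  by rewrite !(antitone_le xA) ?leq_add2l ?leq_addr.
have mc k : k < e.-1 -> m (i + k) = c.-1.
  move=> lt_k; have := xS (i + k); have := xm (i + k).
  by rewrite -addnS !xc //; lia.
(* If a segment starts in row [i], it runs through all [e] rows and the rows of [m] from [i] on are
   equal; otherwise the run in [m] starts one row higher. Both are refuted through [mreg]. *)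
have [uc|uc] : u i = c \/ c < u i.
  have := reach_bounds e_gt1 xA i; rewrite reachE -?cE; lia.
  have uk k : k <= e.-1 -> u (i + k) = c + k.
    elim: k => [|k IHk] lt_k; first by rewrite !addn0.
    rewrite -reachE; last lia.
    rewrite addnS /= reachE; last lia.
    by rewrite IHk ?(ltnW lt_k) // -addnS xc //; case: ifP; lia.
  have := uk _ (leqnn _); have := ub _ ie; have := xm _ ie; rewrite xc // => b1 b2 b3.
  have mE : m i = m (i + e.-1) by rewrite -[i in LHS]addn0 mc; lia.
  have [_ ir lt_fe] := mreg ie mE.
  by move: ur; rewrite -ir b3; case: eqP; lia.
case: i => [|i] in xie cE ie xc mc uc *; first by move: uc; rewrite /x /= in cE; lia.
have mi : m i = c.-1.
  have lt_ir : i < r by lia.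
  have := reachE _ lt_ir; rewrite /= reachE ?(ltnW lt_ir) // -cE.
  have := xm _ (ltnW lt_ir); have := xS i; have := stripE i.
  by rewrite /strip -cE reachE ?(ltnW lt_ir) //; case: ifP; lia.
have ie' : i + e.-1 <= r by lia.
have mE : m i = m (i + e.-1).
  by rewrite mi -(mc e.-2); [congr m; lia | lia].
by have [_] := mreg ie' mE; lia.
Qed.

End Unstrip.

(** * The e-rim as a list of boxes *)

Fixpoint stacked i (rs : seq (seq (nat * nat))) :=
  if rs is r :: rs' then
    [&& r != [::], all (fun b => b.1 == i) r & stacked i.+1 rs']
  else true.

(* b is the number of boxes that remain to be taken in the current segment. *)
Fixpoint walk e b (rs : seq (seq (nat * nat))) :=
  if rs is r :: rs' then
    take b r :: walk e (if b <= size r then e else b - size r) rs'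
  else [::].

Lemma mem_stacked i rs c : stacked i rs -> c \in flatten rs -> i <= c.1.
Proof.
elim: rs i => //= r rs IHrs i /and3P[_ /allP ri /IHrs rsi].
by rewrite mem_cat => /orP[/ri/eqP->|/rsi/ltnW].
Qed.

Lemma filter_stacked i j rs : stacked i rs -> j < i ->
  [seq c <- flatten rs | j < c.1] = flatten rs.
Proof.
move=> rsi lt_ji; apply/all_filterP/allP=> c /(mem_stacked rsi).
exact: leq_trans.
Qed.

Lemma filter_row i j (r : seq (nat * nat)) : all (fun b => b.1 == i) r -> i <= j ->
  [seq c <- r | j < c.1] = [::].
Proof.
move=> /allP ri le_ij; apply/eqP; rewrite -[_ == _]negbK -has_filter.
by apply/hasPn => c /ri/eqP->; rewrite -leqNgt.
Qed.

Lemma last_row i d (r : seq (nat * nat)) :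
  all (fun b => b.1 == i) r -> r != [::] -> (last d r).1 = i.
Proof. by case: r => // c r /allP ri _; apply/eqP/ri; rewrite /= mem_last. Qed.

Lemma erim_walkS e fuel d s : 0 < e -> s != [::] ->
  erim_walk fuel.+1 e s =
  take e s ++ erim_walk fuel e [seq c <- s | (last d (take e s)).1 < c.1].
Proof. by case: e s => // e [|c s]. Qed.

(** Where a segment ends, the filter of [erim_walk] drops the rest of that row and keeps the rows
    below, so the walk can be done row by row. Each segment uses up at least one row, which bounds
    the fuel. *)
Lemma erim_walkE e fuel b d i rs : 0 < e -> 0 < b -> stacked i rs ->
    size rs <= fuel.+1 -> rs != [::] ->
  let seg := take b (flatten rs) in
  seg ++ erim_walk fuel e [seq c <- flatten rs | (last d seg).1 < c.1] =
  flatten (walk e b rs).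
Proof.
move=> e_gt0; elim: rs fuel b d i => // r rs IHrs fuel b d i b_gt0 /=.
case/and3P=> r_n0 ri rsi; rewrite ltnS => le_rsf _.
case: leqP => [le_br|lt_rb].
  have t_n0 : take b r != [::] by rewrite -size_eq0 size_takel //; lia.
  have ti : all (fun c => c.1 == i) (take b r).
    by apply/allP => c /mem_take/(allP ri).
  rewrite takel_cat // filter_cat (last_row _ ti) // (filter_row ri) //=.
  rewrite (filter_stacked rsi) //; congr (_ ++ _).
  case: rs => [|r' rs] in IHrs rsi le_rsf *; first by case: fuel le_rsf.
  case: fuel => // fuel in le_rsf *; rewrite -(IHrs fuel e (0, 0) i.+1) //.
  rewrite (erim_walkS _ (0, 0)) //; case/and3P: rsi.
  by rewrite -!size_eq0 /= size_cat; lia.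
rewrite take_cat ltnNge ltnW //= last_cat (take_oversize (ltnW lt_rb)) -catA.
congr (_ ++ _); case: rs => [|r' rs] in IHrs rsi le_rsf *.
  by rewrite /= cats0 (last_row _ ri) // (filter_row ri) //; case: fuel {le_rsf}.
rewrite -(IHrs fuel _ (last d r) i.+1) //; [|lia..].
rewrite filter_cat (filter_row ri) //.
set seg := take _ _; have seg_n0 : seg != [::].
  case/and3P: (rsi); rewrite -!size_eq0 size_take /= size_cat.
  by case: ifP; lia.
apply: ltnW; apply: (mem_stacked rsi); apply: (@mem_take (b - size r)).
by rewrite -/seg; case: seg seg_n0 => //= c s _; apply: mem_last.
Qed.

Lemma stacked_walk e b i rs : 0 < e -> 0 < b -> stacked i rs -> stacked i (walk e b rs).
Proof.
move=> e_gt0; elim: rs b i => //= r rs IHrs b i b_gt0 /and3P[r_n0 ri rsi].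
rewrite IHrs //; last by case: ifP; lia.
rewrite andbT; apply/andP; split; last by apply/allP => c /mem_take/(allP ri).
by rewrite -size_eq0 size_take; move: r_n0; rewrite -size_eq0; case: ifP; lia.
Qed.

Lemma size_walk e b rs : size (walk e b rs) = size rs.
Proof. by elim: rs b => //= r rs IHrs b; rewrite IHrs. Qed.

Lemma count_stacked i rs k : stacked i rs ->
  count (fun b => b.1 == i + k) (flatten rs) = size (nth [::] rs k).
Proof.
elim: rs i k => [|r rs IHrs] i k /=; first by rewrite nth_nil.
case/and3P=> _ /allP ri rsi; rewrite count_cat; case: k => [|k] /=.
  rewrite addn0 (_ : count _ (flatten rs) = 0) ?addn0; last first.
    apply/eqP; rewrite -leqn0 leqNgt -has_count; apply/hasPn => c /(mem_stacked rsi).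
    by case: eqP => // ->; rewrite ltnn.
  by apply/eqP; rewrite -all_count; apply/allP.
rewrite -addSnnS IHrs // (_ : count _ r = 0) //; apply/eqP.
by rewrite -leqn0 leqNgt -has_count; apply/hasPn => c /ri/eqP->; lia.
Qed.

Lemma size_undup_stacked i rs : stacked i rs ->
  size (undup [seq b.1 | b <- flatten rs]) = size rs.
Proof.
move=> rsi; rewrite -(size_iota i (size rs)); apply: perm_size.
apply: uniq_perm; rewrite ?undup_uniq ?iota_uniq // => j.
rewrite mem_undup mem_iota; elim: rs i rsi => [|r rs IHrs] i /=; first by rewrite in_nil; lia.
case/and3P=> r_n0 /allP ri rsi; rewrite map_cat mem_cat (IHrs i.+1) //.
have -> : (j \in [seq b.1 | b <- r]) = (j == i).
  apply/mapP/eqP => [[c /ri/eqP <-] //|->].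
  by case: r r_n0 ri => // c r _ ri; exists c; rewrite ?mem_head //; apply/esym/eqP/ri/mem_head.
lia.
Qed.

Lemma nth_antitone l : is_partition l -> antitone (nth 0 l).
Proof.
case/andP=> ls _ i; have [lt_i|ge_i] := ltnP i.+1 (size l).
  have geq_trans : transitive geq by move=> a b c /=; lia.
  have geq_refl : reflexive geq by move=> a /=.
  by apply: (sorted_leq_nth geq_trans geq_refl 0 ls); rewrite ?inE //; lia.
by rewrite nth_default.
Qed.

Lemma nth_rows l : is_partition l -> rows (nth 0 l) (size l).
Proof.
case/andP=> _ l0 i; have [lt_i|ge_i] := ltnP i (size l); last by rewrite nth_default.
by rewrite lt0n; apply: contraNneq l0 => <-; apply: mem_nth.
Qed.

Definition rim_row l i :=
  [seq b <- [seq (i, j) | j <- rev (iota 0 (nth 0 l i))] | ~~ in_diagram l (b.1.+1, b.2.+1)].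

Lemma rimE l : rim l = flatten [seq rim_row l i | i <- iota 0 (size l)].
Proof. by rewrite /rim /boxes filter_flatten -map_comp. Qed.

Lemma size_rim_row l i : is_partition l ->
  size (rim_row l i) = nth 0 l i - (nth 0 l i.+1).-1.
Proof.
move=> /nth_antitone/(_ i); rewrite /rim_row size_filter count_map count_rev.
rewrite /in_diagram /=; set y := nth 0 l i.+1; set x := nth 0 l i => le_yx.
have -> : x = y.-1 + (x - y.-1) by lia.
rewrite iotaD count_cat add0n addKn (_ : count _ _ = 0); last first.
  apply/eqP; rewrite -leqn0 leqNgt -has_count; apply/hasPn => j.
  by rewrite mem_iota /=; lia.
rewrite -[RHS](size_iota y.-1); apply/eqP; rewrite -all_count.
by apply/allP => j; rewrite mem_iota /=; lia.
Qed.

Lemma stacked_rim l i s : is_partition l -> i + s <= size l ->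
  stacked i [seq rim_row l k | k <- iota i s].
Proof.
move=> lP; elim: s i => //= s IHs i le_is; rewrite IHs; last lia.
rewrite andbT -size_eq0 size_rim_row //; apply/andP; split.
  by have := nth_antitone lP i; have := nth_rows lP i; lia.
by apply/allP => b; rewrite mem_filter => /andP[_ /mapP[j _ ->]].
Qed.

Lemma erimE e l : 0 < e -> is_partition l ->
  erim e l = flatten (walk e e [seq rim_row l i | i <- iota 0 (size l)]).
Proof.
move=> e_gt0 lP; have rsP := @stacked_rim l 0 _ lP (leqnn (size l)).
rewrite /erim rimE; set rs := [seq _ | _ <- _] in rsP *.
have szrs : size rs = size l by rewrite size_map size_iota.
case: (altP (rs =P [::])) => [-> //|rs_n0].
have : 0 < size (flatten rs).
  by case: (rs) rs_n0 rsP => // r rs' _ /and3P[]; rewrite -size_eq0 /= size_cat; lia.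
have : size rs <= size (flatten rs).
  elim: (rs) (0) rsP => //= r rs' IHrs i /and3P[r_n0 _ /IHrs].
  by rewrite size_cat; move: r_n0; rewrite -size_eq0 -add1n -lt0n => r_gt0; apply: leq_add.
case: (size (flatten rs)) => // f le_f _.
rewrite (erim_walkS _ (0, 0)) // -?size_eq0; last first.
  by case: (rs) rs_n0 rsP => // r rs' _ /and3P[]; rewrite -size_eq0 /= size_cat; lia.
by rewrite (erim_walkE _ e_gt0 e_gt0 rsP).
Qed.

(** The value of [b] is what is left of the current segment, [reach - x k] of its [e] boxes having
    been taken above row [k]. *)
Lemma size_walk_rim e l k s b : 1 < e -> is_partition l -> k + s = size l ->
    (0 < s -> b = nth 0 l k + e - reach e (nth 0 l) k) ->
  map size (walk e b [seq rim_row l i | i <- iota k s]) =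
  [seq nth 0 l i - strip e (nth 0 l) i | i <- iota k s].
Proof.
move=> e_gt1 lP; elim: s k b => //= s IHs k b ks /(_ isT) bE.
have := reach_bounds e_gt1 (nth_antitone lP) k; have := nth_antitone lP k.
rewrite size_take size_rim_row // => yx ub; congr (_ :: _).
  by rewrite bE /strip; case: ifP; lia.
apply: IHs => [|s_gt0]; first lia.
have := nth_rows lP k.+1; rewrite -ks => y_gt0 /=.
by rewrite bE; case: ifP; case: ifP; lia.
Qed.

Section Erim.
Variables (e : nat) (l : seq nat).
Hypotheses (e_gt1 : 1 < e) (lP : is_partition l).
Let x := nth 0 l.
Let ws := walk e e [seq rim_row l i | i <- iota 0 (size l)].

Let wsP : stacked 0 ws.
Proof. by apply: stacked_walk; rewrite ?(ltnW e_gt1) // stacked_rim. Qed.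

Let size_ws : map size ws = [seq x i - strip e x i | i <- iota 0 (size l)].
Proof. by apply: size_walk_rim => //= _; rewrite /x addnC addnK. Qed.

Lemma erim_rowsE : erim_rows e l = size l.
Proof.
rewrite /erim_rows erimE ?(ltnW e_gt1) // (size_undup_stacked wsP).
by rewrite size_walk size_map size_iota.
Qed.

Lemma size_erim : size (erim e l) = \sum_(i < size l) (x i - strip e x i).
Proof.
rewrite erimE ?(ltnW e_gt1) // size_flatten /shape size_ws.
by rewrite sumnE big_map -(big_mkord xpredT (fun i => x i - strip e x i)) /index_iota subn0.
Qed.

Lemma count_erim i : i < size l -> count (fun b => b.1 == i) (erim e l) = x i - strip e x i.
Proof.
move=> lt_i; rewrite erimE ?(ltnW e_gt1) //.
rewrite -[i in LHS]add0n (count_stacked _ wsP).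
have szws : size ws = size l by rewrite size_walk size_map size_iota.
rewrite -(nth_map _ 0 size) ?szws // size_ws (nth_map 0) ?size_iota //.
by rewrite nth_iota.
Qed.

Lemma remove_erimE :
  remove_erim e l = [seq y <- [seq strip e x i | i <- iota 0 (size l)] | y != 0].
Proof.
congr filter; apply/eq_in_map => i; rewrite mem_iota => /andP[_ lt_i].
rewrite count_erim // subKn //; have := leq_strip e_gt1 (nth_antitone lP) i.
by rewrite -/x; lia.
Qed.

End Erim.

(** * Adding and removing e-rims *)

Definition nonzero_rows (m : nat -> nat) s := [seq y <- [seq m i | i <- iota 0 s] | y != 0].

Lemma eq_partition l l' : is_partition l -> is_partition l' ->
  nth 0 l =1 nth 0 l' -> l = l'.
Proof.
move=> lP l'P eq_ll'; apply: (@eq_from_nth _ 0) => //.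
have := nth_rows lP (size l'); have := nth_rows l'P (size l).
have := nth_rows lP (size l); have := nth_rows l'P (size l'); rewrite !eq_ll'; lia.
Qed.

Lemma nonzero_rows_partition m s : antitone m -> is_partition (nonzero_rows m s).
Proof.
move=> mA; rewrite /is_partition mem_filter /= andbT.
apply: sorted_filter; first by move=> a b c /=; lia.
rewrite sorted_map; apply: (sub_sorted (e := leq)); last exact: iota_sorted.
by move=> i j /=; apply: antitone_le.
Qed.

Lemma nth_nonzero_rows m s : antitone m -> (forall i, s <= i -> m i = 0) ->
  nth 0 (nonzero_rows m s) =1 m.
Proof.
move=> mA; elim: s m mA => [|s IHs] m mA m0 i; first by rewrite nth_nil m0.
rewrite /nonzero_rows /= -[1]/(1 + 0) iotaDl -map_comp; case: eqP => [m00|/eqP m00] /=.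
  have {m0} m0 k : m k = 0 by apply/eqP; rewrite -leqn0 -m00 antitone_le.
  rewrite (eq_map (g := fun=> 0)); last by move=> k /=; rewrite m0.
  rewrite (_ : filter _ _ = [::]) ?nth_nil //; apply/eqP; rewrite -[_ == _]negbK -has_filter.
  by apply/hasPn => k /mapP[? _ ->].
case: i => [//|i] /=; apply: (IHs (fun k => m k.+1)) => [k|k le_sk]; [exact: mA|exact: m0].
Qed.

Lemma sumn_nonzero_rows m s : sumn (nonzero_rows m s) = \sum_(i < s) m i.
Proof.
rewrite sumnE big_filter big_map -(big_mkord xpredT m) /index_iota subn0 big_mkcond.
by apply: eq_bigr => i _; case: eqP.
Qed.

Lemma sumn_nth l : sumn l = \sum_(i < size l) nth 0 l i.
Proof. by rewrite sumnE (big_nth 0) big_mkord. Qed.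

Lemma e_regularE e l : 1 < e -> is_partition l ->
  e_regular e l <-> regular e (nth 0 l).
Proof.
move=> e_gt1 lP; have lA := nth_antitone lP; split=> [/allP lreg i x_gt0|lreg].
  have := antitone_le lA (leq_addr e.-1 i); rewrite leq_eqVlt => /orP[/eqP xE|//].
  have lt_l : i + e.-1 < size l by rewrite -(nth_rows lP).
  have := lreg _ (mem_nth 0 lt_l); rewrite ltnNge => /negP[].
  set c := nth 0 l (i + e.-1) in xE *; rewrite -[X in count_mem _ X](cat_take_drop i) count_cat.
  rewrite -[X in _ + count_mem _ X](cat_take_drop e) count_cat.
  apply: leq_trans (leq_addl _ _); apply: leq_trans (leq_addr _ _).
  have sz : size (take e (drop i l)) = e by rewrite size_takel // size_drop; lia.
  rewrite -[X in X <= _]sz eq_leq //; apply/esym/eqP; rewrite -all_count.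
  apply/(all_nthP 0) => j; rewrite sz => lt_je; rewrite nth_take // nth_drop /=.
  by rewrite eqn_leq {1}xE /c !(antitone_le lA) ?leq_addr //; lia.
apply/allP => c cl; have [s sP cs] : exists2 s, s < size l & nth 0 l s = c by apply/nthP.
(* Row [i] is the first of length [c]; regularity confines all such rows to the [e.-1] rows from
   there. *)
have [i /eqP ic imin] := ex_minnP (ex_intro (fun s => nth 0 l s == c) s (introT eqP cs)).
have c_gt0 : 0 < c by rewrite -cs (nth_rows lP).
rewrite -[X in count_mem _ X](mkseq_nth 0) /mkseq count_map -size_filter.
apply: (@leq_ltn_trans (size (iota i e.-1))); last by rewrite size_iota; lia.
apply: uniq_leq_size => [|j]; first by rewrite filter_uniq ?iota_uniq.
rewrite mem_filter mem_iota => /andP[/eqP /= jc _]; rewrite mem_iota.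
rewrite imin ?jc //= ltnNge; apply/negP => le_ij.
have := antitone_le lA le_ij; have := lreg i; rewrite jc ic.
have := antitone_le lA (leq_addr e.-1 i); rewrite ic; lia.
Qed.

Section Remove.
Variables (e : nat) (l : seq nat).
Hypotheses (e_gt1 : 1 < e) (lP : is_partition l).
Let lA := nth_antitone lP.

Lemma remove_erim_partition : is_partition (remove_erim e l).
Proof. by rewrite remove_erimE //; apply/nonzero_rows_partition/strip_antitone. Qed.

Lemma nth_remove_erim : nth 0 (remove_erim e l) =1 strip e (nth 0 l).
Proof.
rewrite remove_erimE //; apply: nth_nonzero_rows => [|i le_i]; first exact: strip_antitone.
by have := leq_strip e_gt1 lA i; have := nth_rows lP i; lia.
Qed.

Lemma sumn_remove_erim : sumn (remove_erim e l) + size (erim e l) = sumn l.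
Proof.
rewrite remove_erimE // size_erim // [sumn (filter _ _)]sumn_nonzero_rows sumn_nth.
rewrite -big_split; apply: eq_bigr => i _ /=; rewrite subnKC //.
by have := leq_strip e_gt1 lA i; lia.
Qed.

Lemma size_erim_gt0 : l != [::] -> 0 < size (erim e l).
Proof.
rewrite size_erim // -size_eq0; case: (size l) (nth_rows lP 0) => // n x0 _.
by rewrite big_ord_recl; have := leq_strip e_gt1 lA 0; rewrite /=; lia.
Qed.

End Remove.

Lemma eq_reach e x y : x =1 y -> reach e x =1 reach e y.
Proof. by move=> xy; elim=> [|i IHi] /=; rewrite ?IHi xy. Qed.

Lemma eq_strip e x y : x =1 y -> strip e x =1 strip e y.
Proof. by move=> xy i; rewrite /strip (eq_reach e xy) xy. Qed.

Lemma dvdn_erim e l : 1 < e -> is_partition l -> l != [::] ->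
  (e %| size (erim e l)) = (e <= reach e (nth 0 l) (size l).-1).
Proof.
move=> e_gt1 lP l_n0; rewrite size_erim //.
have [r sE] : exists r, size l = r.+1 by case: (l) l_n0 => // c s; exists (size s).
rewrite sE /= dvdn_strip_total //; first exact: nth_antitone.
by rewrite -sE; apply: nth_rows.
Qed.

(** By [strip_run], [e] equal rows of [m] can only be zero rows ending at the last row of [l], under
    an incomplete last segment. This gives the regularity and the upper bound; an incomplete last
    segment removes the whole last row, which gives the lower bound. *)
Lemma remove_erim_regular e l : 1 < e -> is_partition l -> l != [::] -> e_regular e l ->
  let m := remove_erim e l in
  e_regular e m /\
  size m + ~~ (e %| size (erim e l)) <= size l < size m + ~~ (e %| size (erim e l)) + e.
Proof.
move=> e_gt1 lP l_n0 /(e_regularE e_gt1 lP) lreg m.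
have mP : is_partition m := remove_erim_partition e_gt1 lP.
have mE : nth 0 m =1 _ := nth_remove_erim e_gt1 lP.
have [lA mA] := (nth_antitone lP, nth_antitone mP).
have [r sE] : exists r, size l = r.+1 by case: (l) l_n0 => // c s; exists (size s).
have xr : rows (nth 0 l) r.+1 by rewrite -sE; apply: nth_rows.
have mr := nth_rows mP; rewrite dvdn_erim // sE /=.
have run i : i + e.-1 <= r -> nth 0 m i = nth 0 m (i + e.-1) ->
    [/\ nth 0 m i = 0, i + e.-1 = r & reach e (nth 0 l) r < e].
  by rewrite !mE; apply: strip_run.
have le_mx i : nth 0 m i <= (nth 0 l i).-1 by rewrite mE leq_strip.
split.
  apply/(e_regularE e_gt1 mP) => i m_gt0; have := antitone_le mA (leq_addr e.-1 i).
  rewrite leq_eqVlt => /orP[/eqP E|//].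
  have le_r : i + e.-1 <= r by have := le_mx (i + e.-1); have := xr (i + e.-1); lia.
  by have [m0 _ _] := run i le_r (esym E); rewrite E m0 in m_gt0.
have sm : size m <= r.+1.
  by have := le_mx r.+1; have := xr r.+1; have := mr r.+1; lia.
have m_r : reach e (nth 0 l) r < e -> size m <= r.
  by have := mE r; have := mr r; have := xr r.+1; rewrite /strip; lia.
have [lt_r|] := ltnP r (size m + e.-1); first by case: leqP m_r => /= ue; lia.
have := mr (size m + e.-1); have := mr (size m); rewrite ltnn => m0 m1 le_r.
have mm : nth 0 m (size m) = nth 0 m (size m + e.-1) by lia.
have [_ ir lt_ue] := run (size m) le_r mm.
by have := m_r lt_ue; rewrite [e <= _]leqNgt lt_ue /=; lia.
Qed.

Lemma erim_window e l : 1 < e -> is_partition l -> l != [::] ->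
  let m := remove_erim e l in
  let a := size (erim e l) in let a' := size (erim e m) in
  a' + size l + ~~ (e %| a') <= a + size m < a' + size l + ~~ (e %| a') + e.
Proof.
move=> e_gt1 lP l_n0 /=; set m := remove_erim e l; have lA := nth_antitone lP.
have mE : nth 0 m =1 _ := nth_remove_erim e_gt1 lP.
have mP : is_partition m := remove_erim_partition e_gt1 lP.
have sr : rows (strip e (nth 0 l)) (size m) by move=> i; rewrite -mE nth_rows.
have s_gt0 : 0 < size l by rewrite lt0n size_eq0.
have := strip_window e_gt1 lA (nth_rows lP) sr s_gt0; rewrite /= !size_erim //.
by congr (is_true (_ + _ + ~~ (_ %| _) <= _ < _ + _ + ~~ (_ %| _) + _));
  apply: eq_bigr => i _; rewrite (eq_strip e mE) mE.
Qed.

Lemma remove_erim_inj e l l' : 1 < e ->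
    is_partition l -> is_partition l' -> l != [::] ->
    remove_erim e l = remove_erim e l' -> size (erim e l) = size (erim e l') ->
    size l = size l' ->
  l = l'.
Proof.
move=> e_gt1 lP l'P l_n0 mE aE sE; apply: eq_partition => //.
have [r rE] : exists r, size l = r.+1 by case: (l) l_n0 => // c s; exists (size s).
have lA := nth_antitone lP; have l'A := nth_antitone l'P.
have lr : rows (nth 0 l) r.+1 by rewrite -rE; apply: nth_rows.
have l'r : rows (nth 0 l') r.+1 by rewrite -rE sE; apply: nth_rows.
apply: (strip_inj e_gt1 lA l'A lr l'r) => [i _|].
  by rewrite -!nth_remove_erim // mE.
have [q qE] := strip_total e_gt1 lA lr; have [q' q'E] := strip_total e_gt1 l'A l'r.
have := lr r; have := l'r r; rewrite ltnSn => r'0 r0.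
have /andP[ub _] := reach_bounds e_gt1 lA r.
have /andP[ub' _] := reach_bounds e_gt1 l'A r.
move: aE; rewrite !size_erim // -sE rE qE q'E.
set f := minn e _; set f' := minn e _ => aE.
have [f0 f'0] : 0 < f <= e /\ 0 < f' <= e by lia.
(* Lengths of last segments lie between 1 and [e]; their predecessors are remainders modulo [e]. *)
have : (q * e + f.-1) %/ e = (q' * e + f'.-1) %/ e by congr (_ %/ _); lia.
by rewrite !divnMDl ?divn_small; lia.
Qed.

(** The residue of [a] fixes the length [f] of the last segment, and [strip_surj] applies. The e-rim
    so obtained has size congruent to [a] modulo [e], and both lie in the window of [erim_window],
    of length [e], so they agree. *)
Lemma remove_erim_surj e m r a : 1 < e -> is_partition m -> e_regular e m -> 0 < r ->
    size m + ~~ (e %| a) <= r < size m + ~~ (e %| a) + e ->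
    let a' := size (erim e m) in
    a' + r + ~~ (e %| a') <= a + size m < a' + r + ~~ (e %| a') + e ->
  exists l, [/\ is_partition l, e_regular e l, remove_erim e l = m,
    size (erim e l) = a & size l = r].
Proof.
move=> e_gt1 mP /(e_regularE e_gt1 mP) mreg r_gt0 rb a' ab.
case: r r_gt0 rb ab => // r _ rb ab; have mA := nth_antitone mP; have mr := nth_rows mP.
pose f := if e %| a then e else a %% e.
have fE : (f < e) = ~~ (e %| a) by rewrite /f; case: ifP => _; rewrite ?ltnn // ltn_mod; lia.
have [||i lt_ri|lt_fe|i le_ir E|x [xA xr xreg xm xf]] := @strip_surj e (nth 0 m) r f e_gt1 mA.
- by rewrite /f /dvdn; case: eqP; lia.
- by rewrite /f; case: ifP => // _; rewrite ltnW // ltn_mod; lia.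
- by have := mr i; lia.
- by have := mr r; rewrite fE in lt_fe; lia.
- by have := mreg i; have := mr i; have := mr (i + e.-1); rewrite fE; split; lia.
have x0 i : r.+1 <= i -> x i = 0 by have := xr i; lia.
pose l := nonzero_rows x r.+1.
have lP : is_partition l by apply: nonzero_rows_partition.
have lE : nth 0 l =1 x := nth_nonzero_rows xA x0.
have sl : size l = r.+1.
  have := nth_rows lP (size l); have := nth_rows lP r.+1.
  have := xr (size l); have := xr r.+1; rewrite -!lE ltnn => -> -> H1 H2.
  by apply/eqP; rewrite eqn_leq leqNgt -H1 /= leqNgt H2 ltnn.
have lm : remove_erim e l = m.
  apply: eq_partition => //; first exact: remove_erim_partition.
  by move=> i; rewrite nth_remove_erim // (eq_strip e lE).
have l_n0 : l != [::] by rewrite -size_eq0 sl.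
exists l; split=> //.
  by apply/e_regularE => // i; rewrite !lE; apply: xreg.
have := erim_window e_gt1 lP l_n0; rewrite lm sl /= -/a'.
have := strip_total e_gt1 xA xr; have -> : \sum_(k < r.+1) (x k - strip e x k) = size (erim e l).
  by rewrite size_erim // sl; apply: eq_bigr => i _; rewrite (eq_strip e lE) lE.
move=> [q qE] wb; have aqE : exists q', a = q' * e + f.
  rewrite /f; case: ifP => [/dvdnP[k kE]|_]; last by exists (a %/ e); apply: divn_eq.
  case: k kE => [|k] kE; last by exists k; rewrite kE mulSn addnC.
  (* The two windows exclude [a = 0], so [a] can be written with a full last segment. *)
  have a0 : a = 0 by rewrite kE.
  move: ab rb; rewrite a0 dvdn0 /a'; case: (altP (m =P [::])) => [->|m_n0] /=; first lia.
  by have := size_erim_gt0 e_gt1 mP m_n0; lia.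
have [q' q'E] := aqE; move: qE wb; rewrite xf => -> wb.
rewrite q'E; congr (_ * e + f); apply/eqP; rewrite eqn_leq.
by apply/andP; split; rewrite leqNgt; apply/negP => /(leq_mul (leqnn e)); lia.
Qed.

(** * Mullineux symbols of fixed points *)

Lemma symbol_rec_fuel e l f f' : 1 < e -> is_partition l -> sumn l <= f -> sumn l <= f' ->
  mullineux_symbol_rec f e l = mullineux_symbol_rec f' e l.
Proof.
move=> e_gt1; elim/ltn_ind: f f' l => f IHf f' l lP.
have [->|l_n0] := eqVneq l [::]; first by case: f f' {IHf} => [|f] [|f'].
have := sumn_remove_erim e_gt1 lP; have := size_erim_gt0 e_gt1 lP l_n0.
case: f IHf => [|f] IHf; first lia.
case: f' => [|f']; first lia.
move=> a_gt0 sE le_f le_f'; case lE: l l_n0 => [//|c s] _ /=; congr (_ :: _).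
rewrite -lE; apply: IHf => //; [exact: remove_erim_partition|lia..].
Qed.

Lemma symbolE e l : 1 < e -> is_partition l -> l != [::] ->
  mullineux_symbol e l =
  (size (erim e l), size l) :: mullineux_symbol e (remove_erim e l).
Proof.
move=> e_gt1 lP l_n0; rewrite {1}/mullineux_symbol -(erim_rowsE e_gt1 lP).
have := sumn_remove_erim e_gt1 lP; have := size_erim_gt0 e_gt1 lP l_n0.
case fE: (sumn l) => [|f]; first lia.
case lE: l l_n0 => [//|c s] _ a_gt0 sE /=; congr (_ :: _).
rewrite -lE in lP sE a_gt0 *.
by apply: symbol_rec_fuel => //; [exact: remove_erim_partition|lia].
Qed.

Lemma partition_ind e (P : seq nat -> Prop) : 1 < e -> P [::] ->
    (forall l, is_partition l -> l != [::] -> P (remove_erim e l) -> P l) ->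
  forall l, is_partition l -> P l.
Proof.
move=> e_gt1 P0 IH l; have [n] := ubnP (sumn l); elim: n l => // n IHn l le_n lP.
have [->//|l_n0] := eqVneq l [::]; apply: IH => //; apply: IHn.
  have := sumn_remove_erim e_gt1 lP; have := size_erim_gt0 e_gt1 lP l_n0; lia.
exact: remove_erim_partition.
Qed.

(** The first column together with the remainder determines the partition, by [remove_erim_inj]. *)
Lemma symbol_inj e l l' : 1 < e -> is_partition l -> is_partition l' ->
  mullineux_symbol e l = mullineux_symbol e l' -> l = l'.
Proof.
move=> e_gt1 lP; move: l lP l'; apply: (partition_ind e_gt1) => [|l lP l_n0 IHl] l' l'P.
  by have [->//|l'_n0] := eqVneq l' [::]; rewrite (symbolE e_gt1 l'P).
rewrite (symbolE e_gt1 lP l_n0).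
have [->//|l'_n0] := eqVneq l' [::]; rewrite (symbolE e_gt1 l'P) //.
case=> aE sE mE; apply: (remove_erim_inj e_gt1) => //.
by apply: IHl => //; apply: remove_erim_partition.
Qed.

Lemma sumn_symbol e l : 1 < e -> is_partition l ->
  sumn [seq c.1 | c <- mullineux_symbol e l] = sumn l.
Proof.
move=> e_gt1 lP; move: l lP; apply: (partition_ind e_gt1) => // l lP l_n0 IHl.
by rewrite (symbolE e_gt1 lP l_n0) /= IHl -(sumn_remove_erim e_gt1 lP) addnC.
Qed.

Definition symbol_fixed e l :=
  map (mullineux_column e) (mullineux_symbol e l) == mullineux_symbol e l.

(** Substituting [2 r = a + eps] in two successive columns turns the window for [r] and that for
    [a - r] into the same window for [a], of length [2e]. The default 0 stands for the empty
    partition after the last column. *)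
Fixpoint fixed_top_row e (s : seq nat) :=
  if s is a :: s' then
    let b := head 0 s' in let eps := ~~ (e %| a) + ~~ (e %| b) in
    [&& 0 < a, odd a == ~~ (e %| a), b + eps <= a < b + eps + e.*2 & fixed_top_row e s']
  else true.

Definition fixed_column e a := (a, (a + ~~ (e %| a))./2).

Lemma column_fixed e a r : 0 < a ->
  (mullineux_column e (a, r) == (a, r)) = (a + ~~ (e %| a) == r.*2).
Proof.
by rewrite /mullineux_column xpair_eqE eqxx /= => a_gt0; case: (e %| a) => /=; lia.
Qed.

Lemma symbol_fixedP e l : 1 < e -> is_partition l -> e_regular e l -> symbol_fixed e l ->
  let s := [seq c.1 | c <- mullineux_symbol e l] in
  [/\ fixed_top_row e s, mullineux_symbol e l = map (fixed_column e) s &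
      head 0 s + ~~ (e %| head 0 s) = (size l).*2].
Proof.
move=> e_gt1 lP; move: l lP; apply: (partition_ind e_gt1) => [_ _|l lP l_n0 IHl lreg].
  by rewrite /mullineux_symbol /= dvdn0.
have a_gt0 := size_erim_gt0 e_gt1 lP l_n0.
have [mreg rb] := remove_erim_regular e_gt1 lP l_n0 lreg.
have mP := remove_erim_partition e_gt1 lP.
rewrite /symbol_fixed (symbolE e_gt1 lP l_n0) /= eqseq_cons column_fixed //.
case/andP=> /eqP aE /(IHl mreg) /= [sfix symE hE].
split=> //; last by rewrite {1}symE /fixed_column aE doubleK.
rewrite sfix a_gt0 andbT /=.
set m := remove_erim e l in mreg rb mP sfix symE hE *.
have -> : head 0 [seq c.1 | c <- mullineux_symbol e m] = size (erim e m).
  by have [->|m_n0] := eqVneq m [::] => //; rewrite (symbolE e_gt1 mP m_n0).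
have {hE} hE : size (erim e m) + ~~ (e %| size (erim e m)) = (size m).*2.
  by have [->|m_n0] := eqVneq m [::]; [rewrite /= dvdn0 | rewrite (symbolE e_gt1 mP m_n0) in hE].
move: aE hE rb; move: (size (erim e l)) (size (erim e m)) (size l) (size m) => a a' r r'.
by case: (e %| a); case: (e %| a') => /=; clear; lia.
Qed.

Lemma fixed_top_row_surj e s : 1 < e -> fixed_top_row e s ->
  exists l, [/\ is_partition l, e_regular e l & mullineux_symbol e l = map (fixed_column e) s].
Proof.
move=> e_gt1; elim: s => [_|a s IHs]; first by exists [::].
case/and4P=> a_gt0 /eqP ao ab sfix; have [m [mP mreg mE]] := IHs sfix.
have hE : head 0 s = size (erim e m) /\ (size m).*2 = head 0 s + ~~ (e %| head 0 s).
  have [m0|m_n0] := eqVneq m [::].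
    by case: s {IHs ab} sfix mE => [|b s]; rewrite m0 // dvdn0.
  move: mE; rewrite (symbolE e_gt1 mP m_n0); case: s sfix {IHs ab} => // b s.
  case/and4P=> b_gt0 /eqP bo _ _ [-> -> _]; split=> //=.
  by move: bo; case: (e %| b) => /= bo; rewrite ?addn0 ?addn1; lia.
case: hE ab => -> hE ab.
have [|||l [lP lreg lm la lr]] := @remove_erim_surj e m (fixed_column e a).2 a e_gt1 mP mreg.
- by rewrite /=; case: (e %| a) ao => /=; lia.
- rewrite /=; move: ab hE; move: (size (erim e m)) (size m) => b r.
  by case: (e %| a) ao => /= ao; case: (e %| b) => /=; clear -ao; lia.
- rewrite /=; move: ab hE; move: (size (erim e m)) (size m) => b r.
  by case: (e %| a) ao => /= ao; case: (e %| b) => /=; clear -ao; lia.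
exists l; split=> //; rewrite (symbolE e_gt1 lP) ?la ?lr ?lm ?mE //.
by rewrite -size_eq0 lr /=; case: (e %| a) ao => /=; lia.
Qed.

Lemma fixed_top_row_partition e s : fixed_top_row e s -> is_partition s.
Proof.
elim: s => // a s IHs /and4P[a_gt0 _ ab /IHs /andP[ss s0]].
rewrite /is_partition /= inE negb_or eq_sym -lt0n a_gt0 s0 !andbT.
by case: s ss ab {IHs s0} => //= b s -> ab; rewrite andbT; lia.
Qed.

(** By [symbol_inj], the partition picked in [mullineux] is [l] exactly when the symbol of [l] is
    fixed. *)
Lemma mfE e n : 1 < e ->
  mf e n = #|[set l : intpart n | e_regular e l & symbol_fixed e l]|.
Proof.
move=> e_gt1; apply: eq_card => l; rewrite !inE; case lreg: (e_regular e l) => //=.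
rewrite /mullineux /symbol_fixed; case: pickP => [m /andP[mreg /eqP mE]|no_m].
  rewrite -mE; apply/eqP/eqP=> [[->] //|/symbol_inj lE].
  congr Some; apply/val_inj/lE => //; by case: (intpartP m); case: (intpartP l).
apply/esym/negbTE/negP => /eqP lE; have := no_m l.
by rewrite lreg lE eqxx.
Qed.

Lemma card_intpart_bij (P Q : pred (seq nat)) (f : seq nat -> seq nat) n :
    (forall l, is_partition l -> P l ->
       [/\ is_partition (f l), Q (f l) & sumn (f l) = sumn l]) ->
    (forall l l', is_partition l -> is_partition l' -> P l -> P l' -> f l = f l' -> l = l') ->
    (forall s, is_partition s -> Q s -> exists l, [/\ is_partition l, P l & f l = s]) ->
  #|[set l : intpart n | P l]| = #|[set l : intpart n | Q l]|.
Proof.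
(* The default [l] is never returned on [P], where [f l] is a partition of [n]. *)
move=> fP f_inj f_surj; pose g (l : intpart n) : intpart n := insubd l (f l).
have gE (l : intpart n) : P l -> val (g l) = f l.
  move=> lP; apply: insubdK; have [lp ln] := intpartP l.
  by have [fl _ fs] := fP _ lp lP; rewrite unfold_in fl fs ln eqxx.
rewrite -(card_in_imset (f := g)); last first.
  move=> l l'; rewrite !inE => lP l'P gll'; apply/val_inj.
  by apply: f_inj => //; [case: (intpartP l)|case: (intpartP l')|rewrite -!gE ?gll'].
apply: eq_card => s; rewrite inE; apply/imsetP/idP => [[l]|sQ].
  rewrite inE => lP ->; rewrite [parts _](gE l) //.
  by have [lp _] := intpartP l; have [] := fP _ lp lP.
have [sp sn] := intpartP s; have [l [lp lP fl]] := f_surj _ sp sQ.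
have lS : is_partition l && (sumn l == n).
  by have [_ _ fs] := fP _ lp lP; rewrite lp -fs fl sn /=.
by exists (IntPart lS); [rewrite inE | apply/val_inj; rewrite gE].
Qed.

Lemma mf_top_row e n : 1 < e -> mf e n = #|[set s : intpart n | fixed_top_row e s]|.
Proof.
move=> e_gt1; rewrite mfE //.
apply: (@card_intpart_bij (fun l => e_regular e l && symbol_fixed e l) _
  (fun l => [seq c.1 | c <- mullineux_symbol e l])) => [l lP|l l' lP l'P|s sP sfix].
- case/andP=> lreg lfix; have [sfix _ _] := symbol_fixedP e_gt1 lP lreg lfix.
  by rewrite sumn_symbol //; split=> //; apply: fixed_top_row_partition sfix.
- case/andP=> lreg lfix /andP[l'reg l'fix] sE; apply: (symbol_inj e_gt1) => //.
  have [_ -> _] := symbol_fixedP e_gt1 lP lreg lfix.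
  by have [_ -> _] := symbol_fixedP e_gt1 l'P l'reg l'fix; rewrite sE.
have [l [lP lreg lE]] := fixed_top_row_surj e_gt1 sfix.
exists l; rewrite lreg /symbol_fixed lE -!map_comp; split=> //; last by rewrite map_id.
rewrite /=; apply/eqP/eq_in_map => a as_ /=; apply/eqP.
have [a_gt0 ao] : 0 < a /\ odd a = ~~ (e %| a).
  elim: s sfix {sP lE} as_ => // b s IHs /and4P[b_gt0 /eqP bo _ /IHs H].
  by rewrite inE => /orP[/eqP->|/H].
by rewrite column_fixed //; case: (e %| a) ao => /=; lia.
Qed.

(** * Absorbing the multiples of 2e *)

Definition bump_head (g : seq nat) := if g is h :: g' then h.+1 :: g' else [::].

Definition unbump_head (g : seq nat) := if g is h :: g' then h.-1 :: g' else [::].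

(* Here d records which adjacent letters of a word without 0 wrap around modulo
   N, and z how many letters 0 follow each of them, from the smallest part up.
   The result g is the list of extra multiples of N to be inserted between the
   letters once the zeros are gone; weight_absorb says that the total size is
   preserved. *)
Fixpoint absorb (d : seq bool) (z : seq nat) : seq nat :=
  match d, z with
  | a :: d', i :: z' =>
    let g := absorb d' z' in
    if a then rcons g i else if i is j.+1 then rcons (bump_head g) j else 0 :: g
  | _, _ => [::]
  end.

(** Without a wrap, the head of [g] tells the cases of [absorb] apart: it is 0 if no letter 0 was
    absorbed and positive after [bump_head]. *)
Fixpoint release (d : seq bool) (g : seq nat) : seq nat :=
  if d is a :: d' then
    let i := last 0 g in let g' := take (size d') g in
    if a then i :: release d' g'
    else if head 0 g == 0 then 0 :: release d' (behead g)
    else i.+1 :: release d' (unbump_head g')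
  else [::].

(** An entry lifts its own part and all later ones, so it counts once for each of them. *)
Fixpoint weight (g : seq nat) :=
  if g is h :: g' then h * (size g').+1 + weight g' else 0.

(** A major index: a wrap lifts every later letter by one multiple of [N]. *)
Fixpoint maj (d : seq bool) :=
  if d is a :: d' then a * size d' + maj d' else 0.

(** The major index of the word with its letters 0: passing from a nonzero letter to 0 always wraps,
    from 0 to a nonzero letter never. *)
Fixpoint zero_cost (d : seq bool) (z : seq nat) :=
  match d, z with
  | a :: d', i :: z' =>
    let k := size z' + sumn z' in
    (if i == 0 then a * k else i + k) + zero_cost d' z'
  | _, _ => 0
  end.

Lemma size_bump_head g : size (bump_head g) = size g.
Proof. by case: g. Qed.

Lemma size_absorb d z : size d = size z -> size (absorb d z) = size d.
Proof.
elim: d z => [|a d IHd] [|i z] //= [dz].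
by case: a i => [] [|i]; rewrite ?size_rcons ?size_bump_head /= IHd.
Qed.

Lemma size_release d g : size (release d g) = size d.
Proof. by elim: d g => //= a d IHd g; case: a => /=; [|case: ifP => _ /=]; rewrite IHd. Qed.

(** Ensures that [bump_head] is only applied to a nonempty list. *)
Lemma last_cons_true a d : last true (a :: d) -> ~~ a -> d != [::].
Proof. by case: d => //=; case: a. Qed.

Lemma absorbK d z : last true d -> size d = size z -> release d (absorb d z) = z.
Proof.
elim: d z => [|a d IHd] [|i z] // dl [dz].
have {}IHd : release d (absorb d z) = z by apply: IHd => //; case: (d) dl.
have gs := size_absorb dz; case: a dl => [_|dl] /=.
  by rewrite last_rcons -gs -cats1 take_size_cat // IHd.
have d_n0 := last_cons_true dl isT.
case: i => [|i] /=; first by rewrite IHd.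
rewrite last_rcons -gs -cats1 take_size_cat ?size_bump_head //.
by case: (absorb d z) gs IHd => [|h g] /=; [case: (d) d_n0 | move=> _ ->].
Qed.

Lemma releaseK d g : last true d -> size d = size g -> absorb d (release d g) = g.
Proof.
elim: d g => [|a d IHd] g dl gd; first by case: g gd.
have {}IHd g' : size d = size g' -> absorb d (release d g') = g'.
  by apply: IHd; case: (d) dl.
case/lastP: g gd => [//|g i]; rewrite size_rcons => -[dg] /=.
rewrite last_rcons dg -cats1 take_size_cat // cats1.
case: a dl => [_|dl] /=; first by rewrite IHd.
have d_n0 := last_cons_true dl isT.
case: g dg => [|h g] dg /=; first by case: (d) d_n0 dg.
by case: eqP => [->|h0] /=; rewrite IHd //= ?size_rcons //; congr (_ :: _); lia.
Qed.

Lemma sumn_absorb d z : last true d -> size d = size z -> sumn (absorb d z) = sumn z.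
Proof.
elim: d z => [|a d IHd] [|i z] // dl [dz].
have {}IHd : sumn (absorb d z) = sumn z by apply: IHd => //; case: (d) dl.
have gs := size_absorb dz; case: a dl => [_|dl] /=.
  by rewrite sumn_rcons IHd addnC.
have d_n0 := last_cons_true dl isT.
case: i => [|i] /=; rewrite ?IHd // sumn_rcons.
by case: (absorb d z) gs IHd => [|h g] /=; [case: (d) d_n0 | lia].
Qed.

Lemma weight_rcons g i : weight (rcons g i) = weight g + sumn g + i.
Proof. by elim: g => //= [|h g IHg]; rewrite ?size_rcons ?IHg; lia. Qed.

(** Appending [i] adds [sumn g + i] to the weight. Without a wrap, bumping the head makes up for the
    missing term of [maj]: it adds [size g], and the extra unit in the sum pays for appending only
    [i.-1]. *)
Lemma weight_absorb d z : last true d -> size d = size z ->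
  weight (absorb d z) + maj d = zero_cost d z.
Proof.
elim: d z => [|a d IHd] [|i z] // dl [dz].
have dl' : last true d by case: (d) dl.
have {}IHd := IHd z dl' dz; have gs := size_absorb dz; have gsum := sumn_absorb dl' dz.
case: a dl => [_|dl] /=; first by rewrite weight_rcons -IHd gsum dz; case: eqP; lia.
have d_n0 := last_cons_true dl isT; rewrite -IHd.
case: i => [|i] //=; rewrite weight_rcons.
case: (absorb d z) gs gsum => [|h g] /= gs; [by case: (d) d_n0 gs | lia].
Qed.

(** * Words in the residues modulo N and the partitions they encode *)

Section Residues.
Variables (N : nat) (A D : pred nat).
Hypotheses (N_gt0 : 0 < N) (D0 : D 0 = false).

(** [D] marks the residues whose parts may not be repeated. *)
Definition wraps u c := (c < u) || (c == u) && D c.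

(* The least value congruent to c that may follow v. *)
Definition next_part v c := c + N * (v %/ N + wraps (v %% N) c).

Definition follows v x := next_part v (x %% N) <= x.

Definition follows_closely v x := x == next_part v (x %% N).

(* A pair (c, h) stands for a part with residue c, lying h * N above the least
   possible one. *)
Fixpoint dec_free v (L : seq (nat * nat)) : seq nat :=
  if L is (c, h) :: L' then
    let y := next_part v c + N * h in y :: dec_free y L'
  else [::].

(* A pair (c, i) stands for a part with residue c <> 0 followed by i parts
   divisible by N. *)
Fixpoint dec_close v (L : seq (nat * nat)) : seq nat :=
  if L is (c, i) :: L' then
    let y := next_part v c in let z := next_part y 0 in
    y :: nseq i z ++ dec_close (if i == 0 then y else z) L'
  else [::].

Fixpoint enc_free v (s : seq nat) : seq (nat * nat) :=
  if s is x :: s' then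
    (x %% N, (x - next_part v (x %% N)) %/ N) :: enc_free x s'
  else [::].

Fixpoint enc_close (s : seq nat) : nat * seq (nat * nat) :=
  if s is x :: s' then
    let: (p, L) := enc_close s' in
    if x %% N == 0 then (p.+1, L) else (0, (x %% N, p) :: L)
  else (0, [::]).

Definition letter c := [&& 0 < c, c < N & A c].

(** The final [true] lifts no letter, hence adds nothing to [maj], and provides the hypothesis
    [last true d] of the absorption lemmas. *)
Fixpoint wrap_seq (cs : seq nat) : seq bool :=
  if cs is c :: cs' then (if cs' is c' :: _ then wraps c c' else true) :: wrap_seq cs' else [::].

Lemma next_part_mod v c : c < N -> next_part v c %% N = c.
Proof. by move=> lt_cN; rewrite /next_part addnC mulnC modnMDl modn_small. Qed.

Lemma next_part_div v c : c < N -> next_part v c %/ N = v %/ N + wraps (v %% N) c.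
Proof. by move=> lt_cN; rewrite /next_part addnC mulnC divnMDl // [c %/ N]divn_small // addn0. Qed.

Lemma next_part0 v : next_part v 0 = N * (v %/ N + (0 < v %% N)).
Proof. by rewrite /next_part /wraps D0 andbF orbF. Qed.

(** Successive letters 0 stand for equal parts, which justifies [nseq] in [dec_close]. *)
Lemma next_part00 v : next_part (next_part v 0) 0 = next_part v 0.
Proof.
by rewrite [next_part v 0]next_part0 next_part0 mulKn // modnMr addn0.
Qed.

Lemma wrap_seqP cs : last true (wrap_seq cs) /\ size (wrap_seq cs) = size cs.
Proof.
by elim: cs => //= c [|c' cs] //= [IH1 IH2]; split; rewrite -?IH2.
Qed.

Lemma letter_mod c : letter c -> (c < N) * (c != 0).
Proof. by case/and3P=> c_gt0 -> _; rewrite -lt0n. Qed.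

Lemma next_part_free v x : follows v x ->
  next_part v (x %% N) + N * ((x - next_part v (x %% N)) %/ N) = x.
Proof.
have : x = x %% N + N * (x %/ N) by rewrite {1}(divn_eq x N) addnC mulnC.
rewrite /follows /next_part; move: (_ + wraps _ _) => k.
move: (x %% N) (x %/ N) => c q ->.
rewrite leq_add2l leq_pmul2l // subnDl -mulnBr => le_k.
by rewrite mulKn // -addnA -mulnDr subnKC.
Qed.

Lemma enc_freeK v s : path follows v s -> dec_free v (enc_free v s) = s.
Proof. by elim: s v => //= x s IHs v /andP[vx xs]; rewrite next_part_free // IHs. Qed.

Lemma dec_freeK v L : all letter (unzip1 L) -> enc_free v (dec_free v L) = L.
Proof.
elim: L v => //= -[c h] L IHL v /= /andP[/letter_mod[lt_cN _] Lc].
by rewrite IHL // [N * h]mulnC addnC modnMDl next_part_mod // addnK mulnK.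
Qed.

Lemma free_path v L : all letter (unzip1 L) -> path follows v (dec_free v L).
Proof.
elim: L v => //= -[c h] L IHL v /= /andP[/letter_mod[lt_cN _] Lc].
rewrite IHL // andbT /follows {1}[N * h]mulnC {1}addnC modnMDl next_part_mod //.
exact: leq_addr.
Qed.

Lemma free_letters v L : all letter (unzip1 L) ->
  all (fun x => letter (x %% N)) (dec_free v L).
Proof.
elim: L v => //= -[c h] L IHL v /= /andP[cl Lc].
by rewrite IHL // [N * h]mulnC addnC modnMDl next_part_mod ?(letter_mod cl) // cl.
Qed.

Lemma enc_free_letters v s : all (fun x => letter (x %% N)) s ->
  all letter (unzip1 (enc_free v s)).
Proof. by elim: s v => //= x s IHs v /andP[-> /IHs->]. Qed.

(** The leading zeros serve the induction, in which they become the zeros attached to the preceding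
    letter. *)
Lemma dec_closeK p z v L : all letter (unzip1 L) -> z %% N = 0 ->
  enc_close (nseq p z ++ dec_close v L) = (p, L).
Proof.
move=> Lc z0; elim: p => [|p IHp] /=; last by rewrite IHp z0.
elim: L v Lc {z0 z} => //= -[c i] L IHL v /= /andP[/letter_mod[lt_cN c_n0] Lc].
set w := if _ then _ else _; have -> : forall j,
    enc_close (nseq j (next_part (next_part v c) 0) ++ dec_close w L) = (j, L).
  by elim=> [|j IHj] /=; rewrite ?IHL // IHj next_part_mod.
by rewrite next_part_mod // (negPf c_n0).
Qed.

Lemma enc_closeK v s : path follows_closely v s ->
  let: (p, L) := enc_close s in
  s = nseq p (next_part v 0) ++ dec_close (if p == 0 then v else next_part v 0) L.
Proof.
elim: s v => //= x s IHs v /andP[/eqP xE xs]; move: (IHs _ xs).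
case: (enc_close s) => p L {IHs}; have [x0 sE|x_n0 ->] := eqVneq (x %% N) 0.
  rewrite x0 in xE; rewrite sE /= -xE {2 4}xE next_part00 -xE.
  by case: p {sE}.
by rewrite /= -xE.
Qed.

Lemma close_path v L : all letter (unzip1 L) -> path follows_closely v (dec_close v L).
Proof.
elim: L v => //= -[c i] L IHL v /= /andP[/letter_mod[lt_cN _] Lc].
rewrite {1}/follows_closely next_part_mod // eqxx /=; set y := next_part v c.
case: i => [|i] /=; first exact: IHL.
rewrite /follows_closely next_part_mod // eqxx /=.
elim: i => [|i IHi] /=; first exact: IHL.
by rewrite next_part_mod // next_part00 eqxx.
Qed.

Lemma close_letters v L : all letter (unzip1 L) ->
  all (fun x => (x %% N == 0) || letter (x %% N)) (dec_close v L).
Proof.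
elim: L v => //= -[c i] L IHL v /= /andP[cl Lc].
rewrite next_part_mod ?(letter_mod cl) // cl orbT all_cat IHL // andbT.
by rewrite all_nseq next_part_mod // eqxx orbT.
Qed.

Lemma close_pos v L : all letter (unzip1 L) -> 0 \notin dec_close v L.
Proof.
elim: L v => //= -[c i] L IHL v /= /andP[/letter_mod[lt_cN c_n0] Lc].
rewrite inE mem_cat !negb_or IHL // andbT; apply/andP; split.
  by rewrite /next_part; move: c_n0; case: (c).
rewrite mem_nseq next_part0 next_part_mod // (_ : 0 < c) ?lt0n // addn1.
by apply/negP => /andP[_ /eqP]; have := N_gt0; nia.
Qed.

Lemma enc_close_letters s : all (fun x => (x %% N == 0) || letter (x %% N)) s ->
  all letter (unzip1 (enc_close s).2).
Proof.
elim: s => //= x s IHs /andP[xl /IHs]; case: (enc_close s) => p L /=.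
by case: eqP xl => //= _ -> ->.
Qed.

(** The multiple of [N] that the value [v] forces on the first letter, and through it on all later
    ones. *)
Definition offset v (L : seq (nat * nat)) :=
  if L is (c, _) :: _ then v %/ N + wraps (v %% N) c else 0.

Lemma sumn_dec_free v L : all letter (unzip1 L) ->
  sumn (dec_free v L) = sumn (unzip1 L) + N * (weight (unzip2 L) +
    maj (wrap_seq (unzip1 L)) + size L * offset v L).
Proof.
elim: L v => [|[c h] L IHL] v /=; first by lia.
case/andP=> /letter_mod[lt_cN _] Lc; rewrite IHL // (wrap_seqP _).2 !size_map.
rewrite /next_part; set T := _ + wraps _ _.
have y_mod : (c + N * T + N * h) %% N = c.
  by rewrite -addnA -mulnDr addnC mulnC modnMDl modn_small.
have y_div : (c + N * T + N * h) %/ N = T + h.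
  by rewrite -addnA -mulnDr addnC mulnC divnMDl // [c %/ N]divn_small // addn0.
case: L IHL Lc => [|[c' h'] L] _ _ /=; first by lia.
rewrite y_mod y_div; set a := wraps c c'.
move: (size L).+1 (weight _) (maj _) (c' + _) => s w m S.
lia.
Qed.

Lemma sumn_dec_close v L : all letter (unzip1 L) ->
  let k := size L + sumn (unzip2 L) in
  sumn (dec_close v L) = sumn (unzip1 L) + N * (zero_cost (wrap_seq (unzip1 L)) (unzip2 L)
    + k * offset v L).
Proof.
elim: L v => [|[c i] L IHL] v /=; first by lia.
case/andP=> /letter_mod[lt_cN c_n0] Lc; rewrite sumn_cat sumn_nseq IHL // size_map.
have c_gt0 : 0 < c by rewrite lt0n.
have zE : next_part (next_part v c) 0 = N * (next_part v c %/ N).+1.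
  by rewrite next_part0 next_part_mod // c_gt0 addn1.
have y_mod := next_part_mod v lt_cN; have y_div := next_part_div v lt_cN.
rewrite zE {1}/next_part -y_div; move: (next_part v c) y_mod y_div {zE} => y y_mod y_div.
case: L {IHL} Lc => [|[c' i'] L] /= Lc; first by case: i => [|i] /=; lia.
have /andP[/letter_mod[_ c'_n0] _] := Lc; have c'_gt0 : 0 < c' by rewrite lt0n.
move: (c' + _) (i' + _) (zero_cost _ _) => S K C.
case: i => [|i] /=; first by rewrite y_mod; set a := wraps c c'; lia.
have w0 : wraps 0 c' = false by rewrite /wraps; case: (c') c'_gt0.
rewrite mulKn // modnMr w0; case: ifP; lia.
Qed.

(** Leading letters 0 would decode to parts 0, by [next_part_00]; the last condition excludes
    them. *)
Definition close_ok s := [&& path follows_closely 0 s,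
  all (fun x => (x %% N == 0) || letter (x %% N)) s & 0 \notin s].

Definition free_ok s := path follows 0 s && all (fun x => letter (x %% N)) s.

Definition free_of_close s :=
  let L := (enc_close s).2 in
  dec_free 0 (zip (unzip1 L) (absorb (wrap_seq (unzip1 L)) (unzip2 L))).

Definition close_of_free s :=
  let L := enc_free 0 s in
  dec_close 0 (zip (unzip1 L) (release (wrap_seq (unzip1 L)) (unzip2 L))).

Lemma next_part_00 : next_part 0 0 = 0.
Proof. by rewrite next_part0 mod0n div0n muln0. Qed.

Lemma close_decode s : close_ok s ->
  dec_close 0 (enc_close s).2 = s /\ all letter (unzip1 (enc_close s).2).
Proof.
case/and3P=> /enc_closeK sE sl s0; split; last exact: enc_close_letters.
move: sE s0; case: (enc_close s) => -[|p] L -> //=.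
by rewrite next_part_00 inE eqxx.
Qed.

Lemma unzip_absorb (L : seq (nat * nat)) (f : seq bool -> seq nat -> seq nat) :
    size (f (wrap_seq (unzip1 L)) (unzip2 L)) = size L ->
  let L' := zip (unzip1 L) (f (wrap_seq (unzip1 L)) (unzip2 L)) in
  unzip1 L' = unzip1 L /\ unzip2 L' = f (wrap_seq (unzip1 L)) (unzip2 L).
Proof. by move=> sz /=; rewrite unzip1_zip ?unzip2_zip // size_map sz. Qed.

Lemma offset0 L : all letter (unzip1 L) -> offset 0 L = 0.
Proof.
case: L => [|[c h] L] //= /andP[/letter_mod[_ c_n0] _].
by rewrite div0n mod0n /wraps ltn0 (negPf c_n0).
Qed.

Lemma free_of_closeP s : close_ok s ->
  [/\ free_ok (free_of_close s), sumn (free_of_close s) = sumn s &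
      close_of_free (free_of_close s) = s].
Proof.
move=> /close_decode[]; rewrite /free_of_close; move: (enc_close s).2 => L sE Ll.
have [dl dsz] := wrap_seqP (unzip1 L).
have dz : size (wrap_seq (unzip1 L)) = size (unzip2 L) by rewrite dsz !size_map.
have [|u1 u2] := @unzip_absorb L absorb; first by rewrite size_absorb // dz size_map.
split.
- by rewrite /free_ok free_path ?u1 // free_letters ?u1.
- rewrite sumn_dec_free ?u1 // u2 offset0 ?u1 // muln0 addn0 weight_absorb //.
  by rewrite -sE sumn_dec_close //= offset0 // muln0 addn0.
rewrite /close_of_free dec_freeK ?u1 // u2 absorbK //.
by rewrite zip_unzip.
Qed.

Lemma close_of_freeP s : free_ok s ->
  close_ok (close_of_free s) /\ free_of_close (close_of_free s) = s.
Proof.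
case/andP=> sp sl; have := enc_free_letters 0 sl; have sE := enc_freeK sp.
rewrite /close_of_free; move: (enc_free 0 s) sE => L sE Ll.
have [dl dsz] := wrap_seqP (unzip1 L).
have dz : size (wrap_seq (unzip1 L)) = size (unzip2 L) by rewrite dsz !size_map.
have [|u1 u2] := @unzip_absorb L release; first by rewrite size_release // dz size_map.
split; first by rewrite /close_ok close_path ?close_letters ?close_pos ?u1.
have := @dec_closeK 0 0 0 _ _ (mod0n _); rewrite /free_of_close /= => -> //; rewrite ?u1 //=.
by rewrite u2 releaseK ?zip_unzip.
Qed.

End Residues.

(** * Top rows of fixed points as words modulo 2e *)

Definition admissible e x := odd x == ~~ (e %| x).

Definition free_parts e l :=
  all (fun x => admissible e x && ~~ (e.*2 %| x)) l && uniq [seq x <- l | ~~ (e %| x)].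

(** A window of length [N] holds one number of each residue; the point is that [wraps] finds it. As
    [odd c + odd u] is at most 2 and has the parity of [c - u], the shift matters only when [c = u]
    is odd. *)
Lemma window_residue N q p c u : 0 < N -> ~~ odd N -> c < N -> u < N ->
  (N * q + c == c + N * (p + ((c < u) || (c == u) && odd c))) =
  (N * p + u + (odd c + odd u) <= N * q + c < N * p + u + (odd c + odd u) + N).
Proof.
move=> N_gt0 N_even lt_cN lt_uN; move wE: (_ || _) => w.
rewrite mulnDr [c + _]addnC eqn_add2r.
have [lt_q|gt_q|->] := ltngtP q (p + w).
- have {lt_q} : N * q + N <= N * p + N * w by rewrite addnC -mulnS -mulnDr leq_mul2l lt_q orbT.
  by case: w wE => wE; rewrite ?muln0 ?muln1; lia.
- have {gt_q} : N * p + N * w + N <= N * q by rewrite -mulnDr addnC -mulnS leq_mul2l gt_q orbT.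
  by case: w wE => wE; rewrite ?muln0 ?muln1; lia.
by rewrite mulnDr eqxx; case: w wE => wE; rewrite ?muln0 ?muln1; lia.
Qed.

Section Admissible.
Variable e : nat.
Hypothesis e_gt1 : 1 < e.
Let N := e.*2.
Let D c := ~~ (e %| c).

Let N_gt0 : 0 < N. Proof. by rewrite /N; lia. Qed.
Let D0 : D 0 = false. Proof. by rewrite /D dvdn0. Qed.

Let dvdn_N x : (e %| x %% N) = (e %| x).
Proof. by rewrite {2}(divn_eq x N) dvdn_addr // /N -muln2 mulnA mulnAC dvdn_mull. Qed.

Let odd_N x : odd (x %% N) = odd x.
Proof. by rewrite {2}(divn_eq x N) oddD oddM odd_double andbF. Qed.

Lemma letter_admissible x :
  letter N (admissible e) (x %% N) = (x %% N != 0) && admissible e x.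
Proof. by rewrite /letter lt0n ltn_pmod // /admissible odd_N dvdn_N. Qed.

Lemma close_letter_admissible x :
  (x %% N == 0) || letter N (admissible e) (x %% N) = admissible e x.
Proof.
rewrite letter_admissible; case: eqP => //= x0.
by rewrite /admissible -odd_N -dvdn_N x0 dvdn0.
Qed.

Lemma follows_closely_admissible a b : admissible e a -> admissible e b ->
  follows_closely N D b a =
  (b + (~~ (e %| a) + ~~ (e %| b)) <= a < b + (~~ (e %| a) + ~~ (e %| b)) + N).
Proof.
move=> aA bA; have aE : a = N * (a %/ N) + a %% N by rewrite mulnC -divn_eq.
have bE : b = N * (b %/ N) + b %% N by rewrite mulnC -divn_eq.
have Dodd x : admissible e x -> ~~ (e %| x) = odd (x %% N) by rewrite odd_N => /eqP<-.
rewrite /follows_closely /next_part /wraps /D dvdn_N !Dodd //.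
by rewrite {1}aE window_residue ?ltn_pmod ?odd_double // -aE -bE.
Qed.

(** Read from the smallest entry up, after an initial 0, each window leaves one choice in a residue
    class. *)
Lemma fixed_top_row_close s : fixed_top_row e s = close_ok N (admissible e) D (rev s).
Proof.
rewrite /close_ok (eq_all close_letter_admissible) all_rev mem_rev.
elim: s => //= a s ->; rewrite rev_cons rcons_path inE negb_or.
have -> : last 0 (rev s) = head 0 s by case: s => // b s; rewrite rev_cons last_rcons.
have [aA|] /= := boolP (admissible e a); last first.
  by rewrite -[_ == ~~ _]/(admissible e a) => /negPf->; rewrite !andbF.
rewrite -[_ == ~~ _]/(admissible e a) aA /= lt0n eq_sym.
case: (path _ _ _); rewrite ?andbF //=; case sA: (all _ _); rewrite ?andbF //=.
rewrite follows_closely_admissible //.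
  by rewrite [RHS]andbCA.
by case: s sA => [_|b s /andP[]//]; rewrite /admissible dvdn0.
Qed.

Lemma follows_leq v x : follows N D v x -> v <= x.
Proof.
apply: leq_trans; rewrite {1}(divn_eq v N) /next_part /wraps.
have := ltn_pmod v N_gt0; move: (v %/ N) (v %% N) (x %% N) => p u c lt_u.
by case: ltnP; case: (_ && _) => /=; lia.
Qed.

(** So chains of [follows] are weakly increasing sequences in which only multiples of [e] are
    repeated. *)
Lemma follows_free a b : b <= a -> follows N D b a = ~~ ((a == b) && D a).
Proof.
have Da : D a = D (a %% N) by rewrite /D dvdn_N.
have aE := divn_eq a N; have bE := divn_eq b N.
rewrite /follows /next_part /wraps Da.
move: aE bE (ltn_pmod a N_gt0) (ltn_pmod b N_gt0).
move: (a %/ N) (a %% N) (b %/ N) (b %% N) => q c p u -> -> lt_c lt_u le_ba.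
have -> : (q * N + c == p * N + u) && D c = (q == p) && ((c == u) && D c).
  have [->|] := eqVneq q p; first by rewrite eqn_add2l.
  by rewrite neq_ltn => /orP[] /leq_mul /(_ (leqnn N)); case: eqP => /=; lia.
rewrite addnC leq_add2r mulnC leq_pmul2r //.
have [lt_cu|le_uc] := ltnP c u; last first.
  have le_pq : p <= q by rewrite leqNgt; apply/negP => /leq_mul /(_ (leqnn N)); lia.
  by case: (_ && D c); rewrite ?addn0 ?addn1 ?andbT ?andbF // ltn_neqAle eq_sym le_pq andbT.
rewrite (ltn_eqF lt_cu) andbF addn1 ltnNge.
by apply/negP => /leq_mul /(_ (leqnn N)); lia.
Qed.

Lemma free_ok_partition t : free_ok N (admissible e) D t -> is_partition (rev t).
Proof.
case/andP=> tp tl; rewrite /is_partition rev_sorted mem_rev; apply/andP; split.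
  by apply: (@path_sorted _ leq 0); apply: sub_path tp => v x; apply: follows_leq.
by apply: contraL tl => t0; apply/allPn; exists 0; rewrite // mod0n.
Qed.

Lemma free_parts_ok s : is_partition s ->
  free_parts e s = free_ok N (admissible e) D (rev s).
Proof.
rewrite /free_ok /free_parts all_rev.
have -> : all (fun x => letter N (admissible e) (x %% N)) s =
    all (fun x => admissible e x && ~~ (N %| x)) s.
  by apply: eq_all => x; rewrite letter_admissible andbC.
elim: s => //= a s IHs sP.
have sP' : is_partition s.
  by move: sP; rewrite /is_partition /= inE negb_or => /andP[/path_sorted-> /andP[_ ->]].
rewrite rev_cons rcons_path.
have -> : last 0 (rev s) = head 0 s by case: (s) => // b s'; rewrite rev_cons last_rcons.
have le_a : head 0 s <= a by case: (s) sP => // b s' /andP[/andP[]].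
rewrite follows_free //.
(* In a sorted list a further copy of the largest part must come next; the default 0 differs from
   [a > 0]. *)
have as_ : (a \in s) = (a == head 0 s).
  have a_gt0 : 0 < a by move: sP; rewrite /is_partition /= inE lt0n negb_or eq_sym => /andP[_ /andP[]].
  case: (s) sP le_a => [|b s'] /= sP le_a; first by rewrite in_nil; lia.
  rewrite inE; case: eqP => //= /eqP ne_ab; apply/negbTE/negP => as'.
  have /andP[/andP[_ bs] _] := sP; have /allP/(_ a as') /= := order_path_min (rev_trans leq_trans) bs.
  lia.
have uE : uniq (if D a then a :: [seq x <- s | D x] else [seq x <- s | D x]) =
    ~~ ((a == head 0 s) && D a) && uniq [seq x <- s | D x].
  by rewrite -as_; case: ifP => Da; rewrite /= ?andbF // mem_filter Da andbT.
rewrite uE; move: (IHs sP').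
case: (admissible e a) (N %| a) (all _ _) (uniq _) (path _ _ _) (_ && D a) => [] [] [] [] [] [] //=.
Qed.

End Admissible.

Lemma mf_free_parts e n : 1 < e -> mf e n = #|[set s : intpart n | free_parts e s]|.
Proof.
move=> e_gt1; rewrite mf_top_row //.
have N_gt0 : 0 < e.*2 by lia.
have D0 : ~~ (e %| 0) = false by rewrite dvdn0.
pose f := free_of_close e.*2 (fun c => ~~ (e %| c)).
pose g := close_of_free e.*2 (fun c => ~~ (e %| c)).
apply: (@card_intpart_bij _ _ (fun s => rev (f (rev s)))) => [s sP|s s' sP s'P|s sP].
- rewrite fixed_top_row_close // => /(free_of_closeP N_gt0 D0)[fok fs _].
  have fP := free_ok_partition e_gt1 fok.
  by rewrite fP free_parts_ok // revK sumn_rev fs sumn_rev.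
- rewrite !fixed_top_row_close // => /(free_of_closeP N_gt0 D0)[_ _ sE].
  move=> /(free_of_closeP N_gt0 D0)[_ _ s'E] /(can_inj revK) fE.
  by apply/(can_inj revK); rewrite -sE -/f fE.
rewrite free_parts_ok // => /(close_of_freeP N_gt0 D0)[gok gE].
have gfix : fixed_top_row e (rev (g (rev s))) by rewrite fixed_top_row_close // revK.
exists (rev (g (rev s))); split=> //; first exact: fixed_top_row_partition gfix.
by rewrite revK [f _]gE revK.
Qed.

(** * Generating functions *)

Section Enumeration.
Variables S D : pred nat.

Definition good_parts l := all S l && uniq [seq x <- l | D x].

(** Lists split by whether the largest allowed part [K] occurs; it stays allowed afterwards unless
    [D K]. Each call decreases [K + n], so any larger fuel suffices. *)
Fixpoint enum_parts f K n : seq (seq nat) :=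
  if f is f'.+1 then
    if K is K'.+1 then
      enum_parts f' K' n ++
      (if S K && (K <= n) then
         [seq K :: l | l <- enum_parts f' (if D K then K' else K) (n - K)]
       else [::])
    else if n == 0 then [:: [::]] else [::]
  else [::].

Lemma enum_partsS f K n : enum_parts f.+1 K.+1 n =
  enum_parts f K n ++
  (if S K.+1 && (K < n) then
     [seq K.+1 :: l | l <- enum_parts f (if D K.+1 then K else K.+1) (n - K.+1)]
   else [::]).
Proof. by []. Qed.

Lemma enum_parts_fuel f f' K n : K + n < f -> K + n < f' ->
  enum_parts f K n = enum_parts f' K n.
Proof.
elim: f f' K n => // f IHf [|f'] [|K] n //= lt_f lt_f'.
rewrite (IHf f') //; try lia.
by case: (boolP (_ && _)) => //= /andP[_ le_n]; rewrite (IHf f') //; case: (D _); lia.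
Qed.

Lemma mem_enum_parts f K n l : K + n < f ->
  (l \in enum_parts f K n) =
  [&& is_partition l, sumn l == n, good_parts l & all (fun x => x <= K) l].
Proof.
elim: f K n l => // f IHf [|K] n l lt_f /=.
  have -> : (l \in if n == 0 then [:: [::]] else [::]) = (l == [::]) && (n == 0).
    by case: (n == 0); rewrite ?inE ?andbT ?andbF.
  case: l => [|x l]; first by rewrite /good_parts /= eq_sym andbT.
  rewrite /= -[RHS]/[&& _, _, _ & _]; apply/esym/negbTE/negP.
  by rewrite /is_partition inE => /and4P[/andP[_]] + _ _ /andP[]; case: x.
rewrite mem_cat IHf; last lia.
have aK s : all (fun x => x <= K) s -> all (fun x => x <= K.+1) s.
  by apply: sub_all => x; apply: leqW.
have [lK|lK] := boolP (all (fun x => x <= K) l).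
  rewrite aK // !andbT; set b := [&& _, _ & _]; rewrite orb_idr //.
  case: ifP => // _ /mapP[s _ lE]; move: lK; rewrite lE /=; lia.
rewrite !andbF /=; case: ifP => [/andP[SK le_n]|SKn]; last first.
  apply/esym/negbTE/negP => /and4P[/andP[lp _] /eqP ln /andP[lS _] laK].
  case/allPn: lK => x xl lt_Kx; have xK : x = K.+1 by have := allP laK x xl; rewrite /=; lia.
  move: SKn; rewrite -xK (allP lS) //=; have := leq_mem_sumn xl; lia.
apply/mapP/and4P => [[s]|[lp /eqP ln lg laK]].
  rewrite IHf; last by case: (D _); lia.
  case/and4P=> /andP[sp s0] /eqP sn /andP[sS su] sK -> /=.
  have sK' : all (fun x => x <= K.+1) s by move: sK; case: (D _) => //; apply: aK.
  rewrite leqnn sK' /is_partition inE eq_sym s0 andbT sn subnKC //; split=> //.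
    by rewrite /= path_min_sorted.
  rewrite /good_parts /= SK sS; case: ifP sK => //= DK sK; rewrite su mem_filter DK andbT.
  by apply/negP => /(allP sK); lia.
case: l lK lp ln lg laK => // x l lK lp ln lg laK.
have xK : x = K.+1.
  have /= /andP[le_x _] := laK; case: (ltngtP x K.+1) le_x => // lt_x _.
  case/allPn: lK => y; rewrite inE => /orP[/eqP->|yl]; first lia.
  have /andP[/=/order_path_min xl _] := lp.
  by have /allP/(_ y yl) := xl (rev_trans leq_trans); rewrite /=; lia.
exists l; last by rewrite xK.
rewrite IHf; last by case: (D _); lia.
have /andP[ls l0] := lp; rewrite /is_partition (path_sorted ls) /=.
move: l0; rewrite inE negb_or => /andP[_ ->].
have -> : sumn l == n - K.+1 by rewrite -ln xK /= addKn.
have /andP[/=/andP[_ lS] lu] := lg.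
rewrite /good_parts lS; case: ifP => DK.
  rewrite xK DK /= mem_filter DK /= in lu; case/andP: lu => Kl -> /=.
  have /andP[_ laK'] := laK; apply/allP => y yl; have := allP laK' y yl.
  by rewrite leq_eqVlt => /orP[/eqP yK|//]; rewrite -yK yl in Kl.
rewrite xK DK in lu; rewrite lu; by case/andP: laK.
Qed.

Lemma enum_parts_uniq f K n : K + n < f -> uniq (enum_parts f K n).
Proof.
elim: f K n => // f IHf [|K] n lt_f /=; first by case: (n == 0).
rewrite cat_uniq IHf /=; last lia.
case: ifP => //= /andP[_ le_n]; rewrite map_inj_uniq; last by move=> s s' [].
rewrite IHf; last by case: (D _); lia.
rewrite andbT; apply/hasPn => l /mapP[s _ ->]; rewrite mem_enum_parts; last lia.
by rewrite /= ltnn !andbF.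
Qed.

Definition num_parts K n := size (enum_parts (K + n).+1 K n).

Lemma num_partsS K n : num_parts K.+1 n = num_parts K n +
  (if S K.+1 && (K < n) then num_parts (if D K.+1 then K else K.+1) (n - K.+1) else 0).
Proof.
rewrite /num_parts enum_partsS size_cat; congr (_ + _).
case: ifP => // /andP[_ le_n]; rewrite size_map.
by rewrite (@enum_parts_fuel _ ((if D K.+1 then K else K.+1) + (n - K.+1)).+1) //; case: (D _); lia.
Qed.

Lemma num_parts0 n : num_parts 0 n = (n == 0).
Proof. by rewrite /num_parts /=; case: eqP. Qed.

Lemma card_good_parts K n : n <= K ->
  #|[set l : intpart n | good_parts l]| = num_parts K n.
Proof.
move=> le_nK; rewrite cardE -(size_map val); apply/perm_size/uniq_perm.
- by rewrite map_inj_uniq ?enum_uniq //; apply: val_inj.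
- exact: enum_parts_uniq.
move=> l; rewrite mem_enum_parts //; apply/mapP/and4P => [[s]|[lp ln lg _]].
  rewrite mem_enum inE => sg ->; have [sp sn] := intpartP s; split=> //; first by rewrite sn.
  by apply/allP => x /leq_mem_sumn; rewrite sn => /leq_trans; apply.
have lS : is_partition l && (sumn l == n) by rewrite lp.
by exists (IntPart lS); rewrite // mem_enum inE.
Qed.

End Enumeration.

(** * Infinite products and the series of restricted partitions *)

Local Open Scope ring_scope.

Definition eq_upto n (p q : {poly int}) := forall m, (m <= n)%N -> p`_m = q`_m.

Lemma eq_upto_mul n p q p' q' : eq_upto n p q -> eq_upto n p' q' ->
  eq_upto n (p * p') (q * q').
Proof.
move=> pq p'q' m le_mn; rewrite !coefM; apply: eq_bigr => i _.
by rewrite pq ?p'q' // (leq_trans _ le_mn) ?leq_subr // -ltnS.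
Qed.

Lemma eq_upto_prod n (I : Type) (s : seq I) (F G : I -> {poly int}) :
  (forall i, eq_upto n (F i) (G i)) ->
  eq_upto n (\prod_(i <- s) F i) (\prod_(i <- s) G i).
Proof.
move=> FG; elim: s => [|i s IHs]; first by rewrite !big_nil.
by rewrite !big_cons; apply: eq_upto_mul.
Qed.

Definition unital (F : nat -> {poly int}) := forall k, exists G, F k = 1 + G * 'X^k.

Lemma unital_if (P : pred nat) (c : {poly int}) :
  unital (fun k => if P k then 1 + c * 'X^k else 1).
Proof. by move=> k; case: (P k); [exists c | exists 0; rewrite mul0r addr0]. Qed.

Lemma eq_upto_infprod F n m : unital F -> (m <= n)%N ->
  infprod F m = (\prod_(k < n.+1) F k)`_m.
Proof. by move=> F1 le_mn; rewrite infprod_stable. Qed.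

Lemma fps_mul_infprod F G : unital F -> unital G ->
  fps_mul (infprod F) (infprod G) =1 infprod (fun k => F k * G k).
Proof.
move=> F1 G1 n; rewrite /fps_mul [RHS]/infprod big_split coefM.
apply: eq_bigr => i _; rewrite (eq_upto_infprod F1 (_ : i <= n)%N) -1?ltnS //.
by rewrite (eq_upto_infprod G1 (leq_subr i n)).
Qed.

Lemma eq_infprod F G : F =1 G -> infprod F =1 infprod G.
Proof. by move=> FG n; rewrite /infprod (eq_bigr (fun k : 'I__ => G k)). Qed.

Lemma infprod1 n : infprod (fun=> 1) n = (n == 0%N)%:R.
Proof. by rewrite /infprod big1 // coef1. Qed.

Lemma fps_mul_infprod1 f : fps_mul f (infprod (fun=> 1)) =1 f.
Proof.
move=> n; rewrite /fps_mul big_ord_recr /= subnn infprod1 mulr1 big1 ?add0r // => i _.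
by rewrite infprod1 subn_eq0 leqNgt ltn_ord mulr0.
Qed.

(** Up to degree [n] the factors with [phi k > n] are 1, and [k <= phi k] puts all others among the
    first [n.+1]; the two finite products then differ only in order. *)
Lemma infprod_reindex (c : {poly int}) (phi : nat -> nat) (P : pred nat) :
    injective phi -> (forall k, (k <= phi k)%N) ->
    (forall j, reflect (exists k, phi k = j) (P j)) ->
  infprod (fun k => 1 + c * 'X^(phi k)) =1 infprod (fun k => if P k then 1 + c * 'X^k else 1).
Proof.
move=> phi_inj le_phi phiP n; rewrite /infprod.
pose s := [seq k <- iota 0 n.+1 | (phi k <= n)%N].
have small : eq_upto n (\prod_(k < n.+1) (1 + c * 'X^(phi k))) (\prod_(k <- s) (1 + c * 'X^(phi k))).
  rewrite -(big_mkord xpredT (fun k => 1 + c * 'X^(phi k))) /index_iota subn0.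
  rewrite big_filter [X in eq_upto _ _ X]big_mkcond; apply: eq_upto_prod => k m le_mn.
  case: leqP => // lt_n; rewrite coefD coefMXn (leq_ltn_trans le_mn) ?addr0 //.
rewrite small // -(big_map phi xpredT (fun k => 1 + c * 'X^k)).
have -> : \prod_(k < n.+1) (if P k then 1 + c * 'X^k else 1) =
    \prod_(k <- [seq k <- iota 0 n.+1 | P k]) (1 + c * 'X^k).
  rewrite -(big_mkord xpredT (fun k => if P k then 1 + c * 'X^k else 1)).
  by rewrite big_filter [RHS]big_mkcond /index_iota subn0.
apply: (congr1 (fun p : {poly int} => p`_n)); apply: perm_big; apply: uniq_perm.
- by rewrite map_inj_uniq // filter_uniq ?iota_uniq.
- by rewrite filter_uniq ?iota_uniq.
move=> j; rewrite mem_filter mem_iota add0n ltnS /=.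
apply/mapP/andP => [[k]|[/phiP[k kj] le_j]].
  by rewrite mem_filter => /andP[le_n _] ->; split=> //; apply/phiP; exists k.
exists k => //; rewrite mem_filter mem_iota add0n ltnS kj le_j /=.
by rewrite (leq_trans (le_phi k)) // kj.
Qed.

Section PartsSeries.
Variables S D : pred nat.
Hypothesis S0 : S 0%N = false.

Let F (k : nat) : {poly int} := if S k && D k then 1 + 1 * 'X^k else 1.
Let G (k : nat) : {poly int} := if S k && ~~ D k then 1 + (- 1) * 'X^k else 1.
Let C B K : {poly int} := \poly_(n < B.+1) (num_parts S D K n)%:R.

(** The recursion [num_partsS], truncated at degree [B]: a part in [D] contributes [1 + 'X^k], a
    repeatable one the inverse of [1 - 'X^k]. *)
Lemma num_parts_rec B K : eq_upto B (C B K.+1 * G K.+1) (C B K * F K.+1).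
Proof.
have CE n K' : (n <= B)%N -> (C B K')`_n = (num_parts S D K' n)%:R.
  by move=> le_n; rewrite coef_poly ltnS le_n.
move=> n le_n; rewrite /F /G; case SK: (S K.+1) => /=; last first.
  by rewrite !mulr1 !CE // num_partsS SK addn0.
case DK: (D K.+1) => /=; rewrite ?mulr1 ?mul1r ?mulN1r mulrDr mulr1 coefD ?mulrN ?coefN coefMXn.
  rewrite (CE _ _ le_n) (CE _ K le_n) num_partsS SK DK /= [(K < n)%N]leqNgt.
  by case: ltnP => //= le_K; rewrite ?(CE (n - K.+1)%N) ?natrD ?addn0 ?addr0 //; lia.
rewrite (CE _ _ le_n) (CE _ K le_n) num_partsS SK DK /= [(K < n)%N]leqNgt.
case: ltnP => //= le_K; rewrite ?addn0 ?subr0 //.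
by rewrite CE ?natrD ?addrK //; lia.
Qed.

Lemma num_parts_prod B K :
  eq_upto B (C B K * \prod_(k < K.+1) G k) (\prod_(k < K.+1) F k).
Proof.
elim: K => [|K IHK].
  rewrite !big_ord_recr !big_ord0 /= /F /G S0 /= !mulr1 => n le_n.
  by rewrite coef_poly ltnS le_n num_parts0 coef1.
rewrite big_ord_recr [X in eq_upto _ _ X]big_ord_recr /= mulrCA mulrC.
move=> n le_n; rewrite (eq_upto_mul (@num_parts_rec B K) (fun _ _ => erefl)) //.
by rewrite mulrAC (eq_upto_mul IHK (fun _ _ => erefl)).
Qed.

(** Euler's product, with its denominators [1 - 'X^k] moved to the left. *)
Lemma good_parts_series :
  fps_mul (fun n => (#|[set l : intpart n | good_parts S D l]|)%:R) (infprod G) =1 infprod F.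
Proof.
move=> n; rewrite [RHS]/infprod -(@num_parts_prod n n) // coefM; apply: eq_bigr => i _.
have le_in : (i <= n)%N by rewrite -ltnS.
rewrite coef_poly ltn_ord (card_good_parts S D le_in); congr (_ * _).
by apply: eq_upto_infprod; [exact: unital_if | exact: leq_subr].
Qed.

End PartsSeries.

(** * The products for chi and the two parities of e *)

Lemma odd_index j : reflect (exists k, k.*2.+1 = j) (odd j).
Proof.
apply: (iffP idP) => [oj|[k <-]]; last by rewrite /= odd_double.
by exists j./2; rewrite -[RHS]odd_double_half oj.
Qed.

Lemma odd_mul_index e j : (0 < e)%N ->
  reflect (exists k, k.*2.+1 * e = j)%N ((e %| j)%N && odd (j %/ e)).
Proof.
move=> e_gt0; apply: (iffP andP) => [[/divnK ej /odd_index[k kE]]|[k <-]].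
  by exists k; rewrite kE.
by rewrite dvdn_mull // mulnK //= odd_double.
Qed.

Lemma infprod_odd : infprod (fun k => 1 + 'X^(k.*2.+1)) =1
  infprod (fun k => if odd k then 1 + 1 * 'X^k else 1).
Proof.
move=> n; rewrite -(@infprod_reindex 1 (fun k => k.*2.+1) odd).
- by apply: eq_infprod => k; rewrite mul1r.
- by move=> k k' [] /double_inj.
- by move=> k; rewrite -addnn; lia.
exact: odd_index.
Qed.

Lemma infprod_odd_mul e (c : {poly int}) : (0 < e)%N ->
  infprod (fun k => 1 + c * 'X^(k.*2.+1 * e)) =1
  infprod (fun k => if (e %| k)%N && odd (k %/ e) then 1 + c * 'X^k else 1).
Proof.
move=> e_gt0; apply: (@infprod_reindex c (fun k => k.*2.+1 * e)%N).
- by move=> k k' /eqP; rewrite eqn_pmul2r // => /eqP[] /double_inj.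
- by move=> k; apply: leq_trans (leq_pmulr _ e_gt0); rewrite -addnn; lia.
by move=> j; apply: odd_mul_index.
Qed.

Lemma chiX : chi 'X =1 infprod (fun k => 1 + 'X^(k.*2.+1)).
Proof.
by apply: eq_infprod => k; rewrite mulNr opprK -exprM -exprS mul2n.
Qed.

Lemma chiXn e : chi 'X^e =1 infprod (fun k => 1 + 'X^(k.*2.+1 * e)).
Proof.
apply: eq_infprod => k; rewrite mulNr opprK -!exprM -exprD.
by congr (1 + 'X^_); rewrite -mul2n; lia.
Qed.

Lemma chiNXn e : chi (- 'X^e) =1 infprod (fun k => 1 - 'X^(k.*2.+1 * e)).
Proof.
apply: eq_infprod => k; rewrite opprK sqrrN -!exprM -exprD.
by congr (1 - 'X^_); rewrite -mul2n; lia.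
Qed.

Lemma eq_fps_mul f f' g g' : f =1 f' -> g =1 g' -> fps_mul f g =1 fps_mul f' g'.
Proof. by move=> ff gg n; apply: eq_bigr => i _; rewrite ff gg. Qed.

Lemma eq_fps_div f f' g g' : g' 0%N \is a GRing.unit -> f =1 f' -> g =1 g' ->
  fps_div f g =1 fps_div f' g'.
Proof.
move=> g0 ff gg; apply: fps_div_unique => // n.
by rewrite -ff -(@fps_divK f g) ?gg //; apply: eq_fps_mul => // m; rewrite gg.
Qed.

Lemma infprod_coef0 (F : nat -> {poly int}) : (F 0%N)`_0 = 1 -> infprod F 0%N \is a GRing.unit.
Proof. by move=> F0; rewrite /infprod big_ord1 F0 unitr1. Qed.

Definition free_part e x := admissible e x && ~~ (e.*2 %| x)%N.

Lemma MF_series e : (1 < e)%N ->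
  fps_mul (MF e)
    (infprod (fun k => if free_part e k && (e %| k)%N then 1 + (- 1) * 'X^k else 1)) =1
  infprod (fun k => if free_part e k && ~~ (e %| k)%N then 1 + 1 * 'X^k else 1).
Proof.
move=> e_gt1 n; have S0 : free_part e 0 = false by rewrite /free_part dvdn0 andbF.
rewrite -(good_parts_series (fun k => ~~ (e %| k)%N) S0); apply: eq_fps_mul n => n.
  by rewrite /MF mf_free_parts // natz.
by apply: eq_infprod => k; rewrite negbK.
Qed.

(** An admissible multiple of an odd [e] is even, hence a multiple of [2e], which is excluded. *)
Lemma free_part_odd e x : odd e -> free_part e x = odd x && ~~ (e %| x)%N.
Proof.
move=> oe; rewrite /free_part /admissible -mul2n Gauss_dvd ?coprime2n // dvdn2.
by case: (odd x); case: (e %| x)%N.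
Qed.

(** A multiple of an even [e] is even, hence admissible, and avoids the multiples of [2e] when its
    quotient is odd. *)
Lemma free_part_even e x : (1 < e)%N -> ~~ odd e ->
  free_part e x = odd x || (e %| x)%N && odd (x %/ e).
Proof.
move=> e_gt1 oe; rewrite /free_part /admissible -mul2n.
have [/dvdnP[k ->]|ne] := boolP (e %| x)%N.
  rewrite oddM (negPf oe) andbF mulnK; last lia.
  by rewrite dvdn_pmul2r ?dvdn2 ?negbK //; lia.
rewrite orbF; case: (odd x) => //=.
by apply: contra ne; apply: dvdn_trans; apply: dvdn_mull.
Qed.

Lemma odd_ndvd e x : ~~ odd e -> odd x -> ~~ (e %| x)%N.
Proof.
by move=> oe; apply: contraL => /dvdnP[k ->]; rewrite oddM (negPf oe) andbF.
Qed.

Theorem theorem3p1 (e : nat) (he : (2 <= e)%N) :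
  (odd e ->
    [/\ forall n : nat, mf e n =
          #|[set l : intpart n | uniq l & all (fun x => odd x && ~~ (e %| x)%N) l]|,
        MF e =1 fps_div (chi 'X) (chi 'X^e),
        MF e =1 fps_div (infprod (fun k => 1 + 'X^(k.*2.+1)))
                        (infprod (fun k => 1 + 'X^(k.*2.+1 * e)))
      & MF e =1 infprod (fun k => if odd k && ~~ (e %| k)%N then 1 + 'X^k else 1)])
  /\
  (~~ odd e ->
    [/\ forall n : nat, mf e n =
          #|[set l : intpart n |
              all (fun x => odd x || (e %| x)%N && odd (x %/ e)%N) l
              & uniq [seq x <- l | odd x]]|,
        MF e =1 fps_div (chi 'X) (chi (- 'X^e))
      & MF e =1 fps_div (infprod (fun k => 1 + 'X^(k.*2.+1)))
                        (infprod (fun k => 1 - 'X^(k.*2.+1 * e)))]).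
Proof.
have e_gt0 : (0 < e)%N by apply: ltnW.
have coef0 (c : {poly int}) : (1 + c * 'X^(0.*2.+1 * e))`_0 = 1.
  by rewrite coefD coef1 coefMXn mul1n e_gt0 addr0.
split=> oe.
  have MFprod : MF e =1 infprod (fun k => if odd k && ~~ (e %| k)%N then 1 + 1 * 'X^k else 1).
    move=> n; rewrite -[LHS]fps_mul_infprod1.
    (* No free part is a multiple of an odd [e], so the denominator is trivial. *)
    rewrite (eq_fps_mul (frefl _) (_ : _ =1 infprod (fun k =>
      if free_part e k && (e %| k)%N then 1 + (- 1) * 'X^k else 1))); last first.
      by apply: eq_infprod => k; rewrite free_part_odd //; case: (e %| k)%N; rewrite ?andbF.
    rewrite MF_series //; apply: eq_infprod => k.
    by rewrite free_part_odd // -andbA andbb.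
  have MFdiv : MF e =1 fps_div (infprod (fun k => 1 + 'X^(k.*2.+1)))
                               (infprod (fun k => 1 + 'X^(k.*2.+1 * e))).
    apply: fps_div_unique => [|n].
      by apply: infprod_coef0; rewrite -['X^_]mul1r.
    rewrite (eq_fps_mul MFprod (_ : _ =1 infprod (fun k => 1 + 1 * 'X^(k.*2.+1 * e)))); last first.
      by apply: eq_infprod => k; rewrite mul1r.
    rewrite (eq_fps_mul (frefl _) (infprod_odd_mul 1 e_gt0)).
    rewrite fps_mul_infprod; try exact: unital_if.
    rewrite infprod_odd; apply: eq_infprod => k.
    (* As [e] is odd, a multiple [j * e] is odd exactly when [j] is: the denominator supplies the
       odd multiples of [e] missing from [MFprod]. *)
    have [/dvdnP[j ->]|] := boolP (e %| k)%N; last by rewrite andbT mulr1.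
    by rewrite andbF !mul1r mulnK // oddM oe !andbT.
  split=> // [n|n|n].
  - rewrite mf_free_parts //; apply: eq_card => l; rewrite !inE /free_parts.
    rewrite andbC (eq_all (fun x => free_part_odd x oe : admissible e x && ~~ (e.*2 %| x)%N = _)).
    case lo: (all _ _); rewrite ?andbF // !andbT.
    by rewrite (all_filterP _) // (sub_all _ lo) // => x /andP[].
  - rewrite MFdiv; apply/esym/eq_fps_div; [|exact: chiX|exact: chiXn].
    by apply: infprod_coef0; rewrite -['X^_]mul1r.
  by rewrite MFprod; apply: eq_infprod => k; rewrite mul1r.
have MFdiv : MF e =1 fps_div (infprod (fun k => 1 + 'X^(k.*2.+1)))
                             (infprod (fun k => 1 - 'X^(k.*2.+1 * e))).
  apply: fps_div_unique => [|n].
    by apply: infprod_coef0; rewrite -['X^_]mul1r -mulNr.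
  rewrite (eq_fps_mul (frefl _) (_ : _ =1 infprod (fun k => 1 + (- 1) * 'X^(k.*2.+1 * e)))); last first.
    by apply: eq_infprod => k; rewrite mulN1r.
  rewrite (eq_fps_mul (frefl _) (infprod_odd_mul (-1) e_gt0)).
  (* The multiples of [e] with odd quotient are the free parts divisible by [e], so this is the
     denominator of [MF_series]. *)
  rewrite (eq_fps_mul (frefl _) (_ : _ =1 infprod (fun k =>
    if free_part e k && (e %| k)%N then 1 + (- 1) * 'X^k else 1))); last first.
    apply: eq_infprod => k; rewrite free_part_even //.
    case ek: (e %| k)%N; rewrite ?andbF // andbT /=.
    by case ok: (odd k) => //; have := odd_ndvd oe ok; rewrite ek.
  rewrite MF_series // infprod_odd; apply: eq_infprod => k.
  rewrite free_part_even //; case ok: (odd k) => /=; first by rewrite (odd_ndvd oe ok).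
  by case: (e %| k)%N; rewrite ?andbF.
split=> // [n|n].
  rewrite mf_free_parts //; apply: eq_card => l; rewrite !inE /free_parts.
  rewrite (eq_all (fun x => free_part_even x he oe : admissible e x && ~~ (e.*2 %| x)%N = _)).
  case lo: (all _ _) => //=; congr uniq; apply: eq_in_filter => x /(allP lo).
  case ox: (odd x) => /=; first by rewrite (odd_ndvd oe ox).
  by case/andP=> ->.
rewrite MFdiv; apply/esym/eq_fps_div; [|exact: chiX|exact: chiNXn].
by apply: infprod_coef0; rewrite -['X^_]mul1r -mulNr.
Qed.
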